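(* Let $n\geq 4$ and let $\{\pi_i\}_{i=1}^{n-1}$ be a family of non-zero polynomial divided difference operators, $\pi_i$ having index $i$. Let $I$ be the set of indices $1\leq i\leq n-1$ for which $\pi_i$ is not a scalar multiple of $\operatorname{Id}$. Then this family satisfies the braid relations and contains at least one operator whose $Q_0$-polynomial vanishes if and only if the following conditions hold: (1) The complement of $I$ in $\{1,\dots,n-1\}$ is not empty, and for every $i$ in that complement we have $\pi_i=\mu\operatorname{Id}$ for the same non-zero constant $\mu$; (2) For any isolated element $i$ of $I$ we have $\pi_i f=\varphi_i\,\partial_i(\psi_i f)$ for all $f$, where $\varphi_i$ and $\psi_i$ are polynomials in $x_i$ and $x_{i+1}$ that satisfy $\partial_i(\varphi_i\psi_i)=\mu$; (3) For every interval $J$ of $I$ there are constants $a,b,c,d$, not all $0$, with $ad-bc=0$ and $b-c=\mu$, such that for every $i\in J$ independently the operator $\pi_i$ has the form $\pi_i f=\partial_i(P^{+}f)+Q_{+}\partial_i f+R_{+}f$ with $(P^{+},Q_{+},R_{+})$ being one of the four triples - $\big(a x_i x_{i+1}+b x_i+c x_{i+1}+d,\ 0,\ 0\big)$; - $\big(a x_i x_{i+1}+c x_i+c x_{i+1}+d,\ (b-c)x_i,\ 0\big)$; - $\big(a x_i^2+(b+c)x_i+c x_{i+1}+d,\ -c x_i,\ -a x_i\big)$; - $\big(c x_{i+1}+d,\ a x_i^2+b x_i,\ -a x_i\big)$. Moreover, every such family generates a Hecke algebra of the form $\mathcal{H}_{\mu,0}$.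
   Context: $K$ is a field of arbitrary characteristic over which all polynomials are defined; possible extra parameters are regarded as elements of $K$, so ''constant'' or ''scalar'' means an element of $K$. The operators act on functions $f$ of variables $x_1,\dots,x_n$ (concretely $f\in K[x_1,\dots,x_n]$). The operator $s_i$ interchanges $x_i$ and $x_{i+1}$, and $\partial_i f=\frac{f-s_i f}{x_i-x_{i+1}}$. A polynomial divided difference operator with index $i$ is an operator of the form $$\pi_i f=\partial_i\big(P(x_i,x_{i+1})f\big)+Q(x_i,x_{i+1})\partial_i f+R(x_i,x_{i+1})f+S(x_i,x_{i+1})s_i f,$$ with two-variable polynomials $P,Q,R,S$ that may differ for different $i$. Its $Q_0$-polynomial $Q_0(u,v)=P(v,u)+Q(u,v)-(u-v)S(u,v)$ depends only on the operator, not on the presentation. The braid relations are $\pi_i\pi_k=\pi_k\pi_i$ for $|k-i|\geq 2$ and $\pi_i\pi_{i+1}\pi_i=\pi_{i+1}\pi_i\pi_{i+1}$ for $1\leq i\leq n-2$. For $I\subseteq\{1,\dots,n-1\}$, an element $i\in I$ is isolated if neither $i-1$ nor $i+1$ lies in $I$. The non-isolated elements of $I$ form a disjoint union of separated maximal sets of (at least two) consecutive integers contained in $I$; these sets are the intervals of $I$. Operators $\{\pi_i\}_{i=1}^{n-1}$ generate a Hecke algebra $\mathcal{H}_{\mu,\nu}$ if they satisfy the braid relations and $\pi_i^2=\mu\pi_i+\nu\operatorname{Id}$ for every $1\leq i\leq n-1$. *)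

(* Defs.v *)
From HB Require Import structures.
From mathcomp Require Import all_boot all_order all_fingroup all_algebra.
From mathcomp.multinomials Require Import mpoly.

Set Implicit Arguments.
Unset Strict Implicit.
Unset Printing Implicit Defensive.

Import GRing.Theory.
Local Open Scope ring_scope.

(* Indices are 0-based: i : 'I_n.-1 has value (usual index) - 1, so that the  *)
(* variables x_i, x_{i+1} attached to it are 'X_(lvar i) and 'X_(rvar i).     *)

Lemma rvar_subproof n (i : 'I_n.-1) : (i.+1 < n)%N.
Proof. by case: n i => [|n] [i lt_i_n]. Qed.

Definition lvar n (i : 'I_n.-1) : 'I_n := widen_ord (leq_pred n) i.
Definition rvar n (i : 'I_n.-1) : 'I_n := Ordinal (rvar_subproof i).

Section Operators.
Variables (K : fieldType) (n : nat).
Implicit Types (i j k : 'I_n.-1) (f g : {mpoly K[n]}).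

Definition xl i : {mpoly K[n]} := 'X_(lvar i).
Definition xr i : {mpoly K[n]} := 'X_(rvar i).

Definition swap i f : {mpoly K[n]} := msym (tperm (lvar i) (rvar i)) f.

Lemma swap_dvd i f : exists g, (xl i - xr i) * g == f - swap i f.
Proof.
have dvdM (u v : {mpoly K[n]}) :
    (exists g, (xl i - xr i) * g == u - swap i u) ->
    (exists g, (xl i - xr i) * g == v - swap i v) ->
  exists g, (xl i - xr i) * g == u * v - swap i (u * v).
  case=> g /eqP gE [h /eqP hE]; exists (g * v + swap i u * h).
  rewrite mulrDr mulrA gE mulrCA hE /swap msymM mulrBl mulrBr addrA.
  by rewrite subrK.
have dvd1 : exists g, (xl i - xr i) * g == 1 - swap i 1.
  by exists 0; rewrite mulr0 /swap msym1 subrr.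
have dvdX (k : 'I_n) : exists g, (xl i - xr i) * g == 'X_k - swap i 'X_k.
  rewrite /swap msymX tpermV.
  have -> : [multinom U_(k)%MM (tperm (lvar i) (rvar i) l) | l < n]
            = U_(tperm (lvar i) (rvar i) k)%MM.
    apply/mnmP => l; rewrite mnmE !mnm1E.
    by rewrite -(inj_eq (@perm_inj _ (tperm (lvar i) (rvar i)))) tpermK.
  case: tpermP => [->|->|_ _].
  - by exists 1; rewrite mulr1.
  - by exists (- 1); rewrite mulrN1 opprB.
  - by exists 0; rewrite mulr0 subrr.
elim/mpolyind: f => [|c m f _ _ [g /eqP gE]].
  by exists 0; rewrite mulr0 /swap msym0 subrr.
have [h /eqP hE] : exists g, (xl i - xr i) * g == 'X_[m] - swap i 'X_[m].
  rewrite mpolyXE_id; elim/big_ind: _ => // k _.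
  by elim: (m k) => [|e IHe]; rewrite ?expr0 // exprS; apply: dvdM.
exists (c *: h + g).
by rewrite mulrDr -scalerAr gE hE /swap msymD msymZ scalerBr opprD addrACA.
Qed.

(* The quotient (f - s_i f) / (x_i - x_{i+1}), taken inside the polynomial    *)
(* ring; it is the unique polynomial satisfying ddiffP.                       *)
Definition ddiff i f : {mpoly K[n]} := xchoose (swap_dvd i f).

Lemma ddiffP i f : (xl i - xr i) * ddiff i f = f - swap i f.
Proof. exact/eqP/(xchooseP (swap_dvd i f)). Qed.

(* p(x_i, x_{i+1}) for a two-variable polynomial p. *)
Definition at_idx i (p : {mpoly K[2]}) : {mpoly K[n]} :=
  p \mPo [tuple xl i; xr i].

Definition pddo i (P Q R S : {mpoly K[2]}) f : {mpoly K[n]} :=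
  ddiff i (at_idx i P * f) + at_idx i Q * ddiff i f
    + at_idx i R * f + at_idx i S * swap i f.

Section Families.
Variables (I : {set 'I_n.-1}) (pi : 'I_n.-1 -> {mpoly K[n]} -> {mpoly K[n]}).

Definition braid_relations : Prop :=
  (forall i k, (i.+1 < k)%N || (k.+1 < i)%N ->
     forall f, pi i (pi k f) = pi k (pi i f)) /\
  (forall i j, j = i.+1 :> nat ->
     forall f, pi i (pi j (pi i f)) = pi j (pi i (pi j f))).

Definition generates_Hecke (mu nu : K) : Prop :=
  braid_relations /\ forall i f, pi i (pi i f) = mu *: pi i f + nu *: f.

Definition scalar_operator i : Prop := exists c : K, forall f, pi i f = c *: f.

Definition isolated i : bool :=
  (i \in I) && [forall j in I, (j.+1 != i :> nat) && (i.+1 != j :> nat)].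

Definition consecutive (J : {set 'I_n.-1}) : bool :=
  [exists p : 'I_n.-1, exists q : 'I_n.-1,
     J == [set j : 'I_n.-1 | (p <= j <= q)%N]].

Definition interval_of (J : {set 'I_n.-1}) : bool :=
  (1 < #|J|)%N && maxset [pred A | consecutive A && (A \subset I)] J.

Definition complement_scalar (mu : K) : Prop :=
  [/\ ~: I != set0, mu != 0 & forall i, i \notin I -> forall f, pi i f = mu *: f].

Definition isolated_form (mu : K) : Prop :=
  forall i, isolated i -> exists phi psi : {mpoly K[2]},
    (forall f, pi i f = at_idx i phi * ddiff i (at_idx i psi * f)) /\
    ddiff i (at_idx i phi * at_idx i psi) = mu%:MP.

Definition has_triple i (P Q R : {mpoly K[n]}) : Prop :=
  forall f, pi i f = ddiff i (P * f) + Q * ddiff i f + R * f.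

Definition interval_form (mu : K) : Prop :=
  forall J, interval_of J -> exists a b c d : K,
    [/\ ~ [/\ a = 0, b = 0, c = 0 & d = 0], a * d - b * c = 0, b - c = mu &
      forall i, i \in J ->
      let x := xl i in let y := xr i in
      [\/ has_triple i (a *: (x * y) + b *: x + c *: y + d%:MP) 0 0,
          has_triple i (a *: (x * y) + c *: x + c *: y + d%:MP)
                       ((b - c) *: x) 0,
          has_triple i (a *: x ^+ 2 + (b + c) *: x + c *: y + d%:MP)
                       (- c *: x) (- a *: x) |
          has_triple i (c *: y + d%:MP) (a *: x ^+ 2 + b *: x) (- a *: x)]].

End Families.
End Operators.

(* Q_0(u, v) = P(v, u) + Q(u, v) - (u - v) S(u, v) with u = 'X_0, v = 'X_1. *)
Definition Q0poly (K : fieldType) (P Q S : {mpoly K[2]}) : {mpoly K[2]} :=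
  let u : {mpoly K[2]} := 'X_ord0 in let v : {mpoly K[2]} := 'X_ord_max in
  P \mPo [tuple v; u] + Q - (u - v) * S.

(* Main.v *)
Require Import Defs.
From HB Require Import structures.
From mathcomp Require Import all_boot all_order all_fingroup all_algebra ring zify.
From mathcomp.multinomials Require Import mpoly.

(* Write (x - y) pi_i f = p f - q s_i f with q the Q_0-polynomial.  On points *)
(* with distinct coordinates, pi_i becomes A f + B (s_i f) with A = p/(x - y) *)
(* and B = - q/(x - y), and comparing the six coefficients (Dedekind          *)
(* independence) turns a braid relation into functional equations for A, B.   *)
(* If q = 0, then pi_i is a multiplication; the degree of its symbol in the   *)
(* variable away from a neighbour vanishes, and two neighbours, or a chain of *)
(* two on one side (this is where n >= 4 enters), make it a constant mu.      *)
(* Such a scalar forces p - s p = mu (x - y) and p (s p) = q (s q), i.e.      *)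
(* pi^2 = mu pi, on its neighbours, and the equations carry this along the    *)
(* whole family.  Factoring p and q through their gcd in K[x, y] gives the    *)
(* form of an isolated operator.  Two adjacent operators with q <> 0 share    *)
(* the same p, whose degree in each variable is at most 1 and whose           *)
(* coefficients satisfy ad = bc; hence p is a product of two linear factors,  *)
(* and p (s p) = q (s q) leaves the four possibilities for q.                 *)

Set Implicit Arguments.
Unset Strict Implicit.
Unset Printing Implicit Defensive.

Import GRing.Theory.
Local Open Scope ring_scope.

(** * Bivariate polynomials *)

(** An operator of index i is determined by a pair (p, q) with (x - y) pi f = p f - q (s f), where x
    = x_i, y = x_{i+1}, s = s_i and q is the Q_0-polynomial ([pddo_is_op], [op_unique]). At a point
    with distinct coordinates a braid relation compares two combinations of the six permuted values
    of f, and their independence ([dedekind_S3]) yields the equations [braid_eqs] for A = p/(x - y)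
    and B = - q/(x - y). The points lie over the fraction field of K[x_1, ..., x_n], with the
    variables themselves as generic coordinates, so degree arguments also work for finite K.

    Necessity. An operator with q = 0 is multiplication by some w. A degree count shows that each
    neighbour removes one variable from w ([scaling_indep]), so two neighbours make w constant
    ([middle_const]). At an end of the family, a non-constant w would force a closed form of A on
    the neighbour ([front]) that the next operator excludes ([first_const], [last_const]). Hence q =
    0 holds exactly for the scalar operators, and one scalar mu spreads p - s p = mu (x - y) and p
    (s p) = q (s q) to all non-scalar operators ([op_type_next], [op_type_all]). Unique
    factorization turns these two identities into phi and psi ([hecke_factor]). Inside an interval
    all p agree ([same_coef_id]) and are bilinear of determinant zero ([braid_bilinear]), hence
    products of two linear factors; q is then found factor by factor ([four_factors]).

    Sufficiency. Every non-scalar operator of the listed forms satisfies the same two identities,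
    which give pi^2 = mu pi ([hecke_pair_quadratic]). Next to a scalar the braid relation reduces to
    this; two adjacent elements of I lie in a common interval, where [lin_braid] checks the
    equations. *)

Lemma mpoly_rmorph_ext n (K : comNzRingType) (A : comNzRingType)
    (f g : {rmorphism {mpoly K[n]} -> A}) :
  (forall c, f c%:MP = g c%:MP) -> (forall i, f 'X_i = g 'X_i) -> f =1 g.
Proof.
move=> fgC fgX p; elim/mpolyind: p => [|c m p _ _ IHp]; first by rewrite !rmorph0.
rewrite !rmorphD IHp -!mul_mpolyC !rmorphM fgC mpolyXE_id !rmorph_prod /=.
congr (_ * _ + _); apply: eq_bigr => i _; by rewrite !rmorphXn fgX.
Qed.

HB.lock Definition ev (K : fieldType) (A : comNzRingType) (c : {rmorphism K -> A})
    (s t : A) (p : {mpoly K[2]}) : A :=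
  mmap c (fun i => if i == ord0 then s else t) p.
Arguments ev {K A} c s t p.

HB.lock Definition sw (K : fieldType) (p : {mpoly K[2]}) : {mpoly K[2]} :=
  ev (@mpolyC 2 K) 'X_ord_max 'X_ord0 p.
Arguments sw {K} p.

(** The outer variable of the image is the first variable u, so a nonzero p has [size (to_poly p)]
    equal to one plus its degree in u. *)
HB.lock Definition to_poly (K : fieldType) (p : {mpoly K[2]}) : {poly {poly K}} :=
  ev (polyC \o polyC) 'X 'X%:P p.
Arguments to_poly {K} p.

HB.lock Definition of_poly (K : fieldType) (r : {poly {poly K}}) : {mpoly K[2]} :=
  (horner_eval 'X_ord0 \o
     map_poly (horner_eval 'X_ord_max \o map_poly (@mpolyC 2 K))) r.
Arguments of_poly {K} r.

Section Bivariate.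
Variable K : fieldType.
Implicit Types (p q : {mpoly K[2]}) (a : K).

Notation u := ('X_ord0 : {mpoly K[2]}).
Notation v := ('X_ord_max : {mpoly K[2]}).

Fact ev_is_zmod_morphism (A : comNzRingType) (c : {rmorphism K -> A}) s t : zmod_morphism (ev c s t).
Proof. by move=> p q; rewrite ev.unlock rmorphB. Qed.

Fact ev_is_monoid_morphism (A : comNzRingType) (c : {rmorphism K -> A}) s t : monoid_morphism (ev c s t).
Proof. by split=> [|p q]; rewrite ev.unlock ?rmorph1 ?rmorphM. Qed.

HB.instance Definition _ (A : comNzRingType) (c : {rmorphism K -> A}) s t := GRing.isZmodMorphism.Build
  {mpoly K[2]} A (ev c s t) (ev_is_zmod_morphism c s t).
HB.instance Definition _ (A : comNzRingType) (c : {rmorphism K -> A}) s t := GRing.isMonoidMorphism.Build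
  {mpoly K[2]} A (ev c s t) (ev_is_monoid_morphism c s t).

Lemma evC (A : comNzRingType) (c : {rmorphism K -> A}) s t a :
  ev c s t a%:MP = c a.
Proof. by rewrite ev.unlock; apply: mmapC. Qed.

Lemma evZ (A : comNzRingType) (c : {rmorphism K -> A}) s t a p :
  ev c s t (a *: p) = c a * ev c s t p.
Proof. by rewrite -mul_mpolyC rmorphM /= evC. Qed.

Lemma evX0 (A : comNzRingType) (c : {rmorphism K -> A}) s t : ev c s t u = s.
Proof. by rewrite ev.unlock mmapX mmap1U. Qed.

Lemma evX1 (A : comNzRingType) (c : {rmorphism K -> A}) s t : ev c s t v = t.
Proof. by rewrite ev.unlock mmapX mmap1U. Qed.

Lemma ord2P (P : 'I_2 -> Prop) : P ord0 -> P ord_max -> forall i, P i.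
Proof.
move=> P0 P1 i.
have /orP[/eqP-> //|/eqP-> //] : (i == ord0) || (i == ord_max).
by case: i => [[|[|]]].
Qed.

Lemma ev_ext (A : comNzRingType) (f g : {rmorphism {mpoly K[2]} -> A}) :
    (forall c, f c%:MP = g c%:MP) -> f u = g u -> f v = g v ->
  f =1 g.
Proof. by move=> fgC f0 f1; apply: mpoly_rmorph_ext => //; exact: ord2P. Qed.

Lemma ev_rmorph (A B : comNzRingType) (c : {rmorphism K -> A})
    (c' : {rmorphism K -> B}) (g : {rmorphism A -> B}) s t p :
  (forall a, g (c a) = c' a) -> g (ev c s t p) = ev c' (g s) (g t) p.
Proof.
move=> gc; apply: (ev_ext (f := g \o ev c s t)) => [a||] /=.
- by rewrite !evC.
- by rewrite !evX0.
- by rewrite !evX1.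
Qed.

Lemma evE (A : comNzRingType) (c : {rmorphism K -> A})
    (f : {rmorphism {mpoly K[2]} -> A}) s t p :
    (forall a, f a%:MP = c a) -> f u = s -> f v = t ->
  f p = ev c s t p.
Proof.
move=> fC <- <-; apply: ev_ext => [a||] /=; by rewrite ?fC ?evC ?evX0 ?evX1.
Qed.

Lemma ev_id p : ev (@mpolyC 2 K) u v p = p.
Proof. by rewrite -(evE (f := idfun) (c := @mpolyC 2 K)). Qed.

Fact sw_is_zmod_morphism : zmod_morphism (@sw K).
Proof. by move=> p q; rewrite sw.unlock rmorphB. Qed.

Fact sw_is_monoid_morphism : monoid_morphism (@sw K).
Proof. by split=> [|p q]; rewrite sw.unlock ?rmorph1 ?rmorphM. Qed.

HB.instance Definition _ := GRing.isZmodMorphism.Build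
  {mpoly K[2]} {mpoly K[2]} (@sw K) (sw_is_zmod_morphism ).
HB.instance Definition _ := GRing.isMonoidMorphism.Build
  {mpoly K[2]} {mpoly K[2]} (@sw K) (sw_is_monoid_morphism ).

Lemma ev_sw (A : comNzRingType) (c : {rmorphism K -> A}) s t p :
  ev c s t (sw p) = ev c t s p.
Proof.
rewrite sw.unlock (ev_rmorph (c' := c)) => [|a] /=; by rewrite ?evC ?evX0 ?evX1.
Qed.

Lemma swC (a : K) : sw (a%:MP : {mpoly K[2]}) = a%:MP. Proof. by rewrite sw.unlock evC. Qed.
Lemma swZ (a : K) (p : {mpoly K[2]}) : sw (a *: p) = a *: sw p.
Proof. by rewrite sw.unlock evZ mul_mpolyC. Qed.
Lemma swX0 : sw u = v. Proof. by rewrite sw.unlock evX0. Qed.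
Lemma swX1 : sw v = u. Proof. by rewrite sw.unlock evX1. Qed.

Lemma swK : involutive (@sw K).
Proof.
by move=> p; rewrite -[RHS]ev_id -[LHS]ev_id !ev_sw.
Qed.

Lemma sw_eq0 p : (sw p == 0) = (p == 0).
Proof. by rewrite -(inj_eq (can_inj swK) p) rmorph0. Qed.

Lemma swE p : p \mPo [tuple v; u] = sw p.
Proof.
rewrite sw.unlock -(evE (f := comp_mpoly [tuple v; u]) (c := @mpolyC 2 K)) //=.
- by move=> a; rewrite comp_mpolyC.
- by rewrite comp_mpolyXU.
- by rewrite comp_mpolyXU.
Qed.

Fact to_poly_is_zmod_morphism : zmod_morphism (@to_poly K).
Proof. by move=> p q; rewrite to_poly.unlock rmorphB. Qed.

Fact to_poly_is_monoid_morphism : monoid_morphism (@to_poly K).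
Proof. by split=> [|p q]; rewrite to_poly.unlock ?rmorph1 ?rmorphM. Qed.

HB.instance Definition _ := GRing.isZmodMorphism.Build
  {mpoly K[2]} {poly {poly K}} (@to_poly K) (to_poly_is_zmod_morphism ).
HB.instance Definition _ := GRing.isMonoidMorphism.Build
  {mpoly K[2]} {poly {poly K}} (@to_poly K) (to_poly_is_monoid_morphism ).

Fact of_poly_is_zmod_morphism : zmod_morphism (@of_poly K).
Proof. by move=> p q; rewrite of_poly.unlock rmorphB. Qed.

Fact of_poly_is_monoid_morphism : monoid_morphism (@of_poly K).
Proof. by split=> [|p q]; rewrite of_poly.unlock ?rmorph1 ?rmorphM. Qed.

HB.instance Definition _ := GRing.isZmodMorphism.Build
  {poly {poly K}} {mpoly K[2]} (@of_poly K) (of_poly_is_zmod_morphism ).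
HB.instance Definition _ := GRing.isMonoidMorphism.Build
  {poly {poly K}} {mpoly K[2]} (@of_poly K) (of_poly_is_monoid_morphism ).

Lemma of_polyC (q : {poly K}) : of_poly q%:P = (map_poly (@mpolyC 2 K) q).[v].
Proof. by rewrite of_poly.unlock /= map_polyC /horner_eval /= hornerC. Qed.

Lemma of_polyX : of_poly 'X = u.
Proof. by rewrite of_poly.unlock /= map_polyX /horner_eval hornerX. Qed.

Lemma to_polyK : cancel (@to_poly K) of_poly.
Proof.
move=> p; rewrite -[RHS]ev_id.
rewrite -(evE (f := of_poly \o to_poly) (c := @mpolyC 2 K)) //= => [a||].
- by rewrite to_poly.unlock evC /= of_polyC map_polyC hornerC.
- by rewrite to_poly.unlock evX0 of_polyX.
- by rewrite to_poly.unlock evX1 of_polyC map_polyX hornerX.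
Qed.

(** With the second argument frozen at t, identities in the first one can be settled by counting
    roots and comparing sizes. *)
Definition ev_fst (A : comNzRingType) (c : {rmorphism K -> A}) (t : A) :
    {mpoly K[2]} -> {poly A} :=
  map_poly (horner_eval t \o map_poly c) \o to_poly.

HB.instance Definition _ A c t := GRing.RMorphism.on (@ev_fst A c t).

Lemma ev_fstE (A : comNzRingType) (c : {rmorphism K -> A}) s t p :
  ev c s t p = (ev_fst c t p).[s].
Proof.
rewrite -(evE (f := horner_eval s \o ev_fst c t) (c := c)) //= => [a||];
  rewrite /horner_eval /ev_fst /= to_poly.unlock.
- by rewrite evC /= map_polyC hornerC /= /horner_eval map_polyC hornerC.
- by rewrite evX0 map_polyX hornerX.
- by rewrite evX1 map_polyC hornerC /= /horner_eval map_polyX hornerX.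
Qed.

Lemma of_polyK : cancel (@of_poly K) to_poly.
Proof.
have toC (q : {poly K}) : to_poly (map_poly (@mpolyC 2 K) q).[v] = q%:P.
  rewrite -horner_map /= {2}to_poly.unlock evX1 -map_poly_comp.
  have -> : map_poly (to_poly \o @mpolyC 2 K) q = map_poly (polyC \o polyC) q.
    by apply: eq_map_poly => a /=; rewrite to_poly.unlock evC.
  by rewrite map_poly_comp /= horner_map /= -[_.['X]]/(q \Po 'X) comp_polyXr.
elim/poly_ind=> [|p a IHp]; first by rewrite !rmorph0.
rewrite rmorphD rmorphM /= rmorphD rmorphM /= IHp.
congr (_ * _ + _).
  by rewrite of_polyX to_poly.unlock evX0.
by rewrite of_polyC toC.
Qed.

End Bivariate.

(** * The functional equations *)

Lemma poly_ext (L : fieldType) (inf : nat -> L) (s : seq L) (f : {poly L}) :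
  injective inf -> (forall x, x \notin s -> f.[x] = 0) -> f = 0.
Proof.
move=> inf_inj f0; apply/eqP/negPn/negP => nz_f.
pose r := [seq inf i | i <- iota 0 (size f + size s)].
have Ur : uniq r by rewrite map_inj_uniq ?iota_uniq.
have /max_poly_roots := nz_f => /(_ [seq x <- r | x \notin s]).
rewrite filter_uniq // => /(_ _ isT) lt_r; have {lt_r} : (size [seq x <- r | x \notin s] < size f)%N.
  by apply: lt_r; apply/allP => x; rewrite mem_filter => /andP[/f0/eqP].
rewrite size_filter ltnNge => /negP[].
have := count_predC (mem s) r; rewrite size_map size_iota => szr.
rewrite -(leq_add2r (size s)) -szr addnC leq_add2l -size_filter.
apply: uniq_leq_size; first exact: filter_uniq.
by move=> x; rewrite mem_filter => /andP[].
Qed.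

(* At a point with x_i = s and x_{i+1} = t, the operator is [coef_id] times the
   identity plus [coef_sw] times s_i; both have the junk value 0 when s = t. *)
HB.lock Definition coef_id (K L : fieldType) (c : {rmorphism K -> L})
  (p : {mpoly K[2]}) (s t : L) : L := ev c s t p / (s - t).
Arguments coef_id {K L} c p s t.

HB.lock Definition coef_sw (K L : fieldType) (c : {rmorphism K -> L})
  (q : {mpoly K[2]}) (s t : L) : L := - (ev c s t q / (s - t)).
Arguments coef_sw {K L} c q s t.

(* The effect on p and q of reversing the order of the variables x_1, ..., x_n;
   it exchanges the left and the right neighbour. *)
HB.lock Definition mirror (K : fieldType) (p : {mpoly K[2]}) : {mpoly K[2]} := - sw p.
Arguments mirror {K} p.

Section FunctionalEquations.
Variables (K L : fieldType) (c : {rmorphism K -> L}).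
Implicit Types p q w : {mpoly K[2]}.

Notation u := ('X_ord0 : {mpoly K[2]}).
Notation v := ('X_ord_max : {mpoly K[2]}).

Notation coef_id := (coef_id c).
Notation coef_sw := (coef_sw c).

(* One equation for each element of S_3, with s = s_i and t = s_{i+1}. *)
Record braid_eqs p1 q1 p2 q2 (x y z : L) : Prop := BraidEqs {
  braid_1 : coef_id p1 x y ^+ 2 * coef_id p2 y z
      + coef_sw q1 x y * coef_sw q1 y x * coef_id p2 x z
    = coef_id p2 y z ^+ 2 * coef_id p1 x y
      + coef_sw q2 y z * coef_sw q2 z y * coef_id p1 x z;
  braid_s : coef_sw q1 x y * (coef_id p1 x y * coef_id p2 y z
      + coef_id p2 x z * coef_id p1 y x - coef_id p2 y z * coef_id p2 x z) = 0;
  braid_t : coef_sw q2 y z * (coef_id p1 x y * coef_id p1 x z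
      - coef_id p2 y z * coef_id p1 x y - coef_id p1 x z * coef_id p2 z y) = 0;
  braid_st : coef_sw q1 x y * coef_sw q2 x z * (coef_id p1 y z - coef_id p2 y z) = 0;
  braid_ts : coef_sw q2 y z * coef_sw q1 x z * (coef_id p1 x y - coef_id p2 x y) = 0;
  braid_sts : coef_sw q1 x y * coef_sw q2 x z * coef_sw q1 y z
    = coef_sw q2 y z * coef_sw q1 x z * coef_sw q2 x y
}.

Definition braid_rel p1 q1 p2 q2 : Prop :=
  forall x y z, x != y -> y != z -> x != z -> braid_eqs p1 q1 p2 q2 x y z.

Lemma mirrorK : involutive (@mirror K).
Proof. by move=> p; rewrite !(coef_id.unlock, coef_sw.unlock, mirror.unlock) rmorphN /= swK opprK. Qed.

Lemma mirror_eq0 p : (mirror p == 0) = (p == 0).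
Proof. by rewrite !(coef_id.unlock, coef_sw.unlock, mirror.unlock) oppr_eq0 sw_eq0. Qed.

Lemma mirror0 : mirror (0 : {mpoly K[2]}) = 0. Proof. by rewrite !(coef_id.unlock, coef_sw.unlock, mirror.unlock) rmorph0 oppr0. Qed.

Lemma mirrorM w : mirror ((u - v) * w) = (u - v) * sw w.
Proof. by rewrite !(coef_id.unlock, coef_sw.unlock, mirror.unlock) rmorphM rmorphB /= swX0 swX1 -mulNr opprB. Qed.

Lemma coef_id_mirror p s t : coef_id (mirror p) s t = coef_id p t s.
Proof. by rewrite !(coef_id.unlock, coef_sw.unlock, mirror.unlock) rmorphN /= ev_sw -(opprB t s) invrN mulrNN. Qed.

Lemma coef_sw_mirror p s t : coef_sw (mirror p) s t = coef_sw p t s.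
Proof. by rewrite !(coef_id.unlock, coef_sw.unlock, mirror.unlock) rmorphN /= ev_sw -(opprB t s) invrN mulrNN. Qed.

Lemma braid_rel_mirror p1 q1 p2 q2 : braid_rel p1 q1 p2 q2 ->
  braid_rel (mirror p2) (mirror q2) (mirror p1) (mirror q1).
Proof.
move=> br x y z xy yz xz.
have zy : z != y by rewrite eq_sym.
have yx : y != x by rewrite eq_sym.
have zx : z != x by rewrite eq_sym.
have [] := br z y x zy yx zx => e1 es et est ets ests.
split; rewrite !(coef_id_mirror, coef_sw_mirror).
- by rewrite e1.
- by rewrite -[RHS]oppr0 -{}et; ring.
- by rewrite -[RHS]oppr0 -{}es; ring.
- by rewrite -[RHS]oppr0 -{}ets; ring.
- by rewrite -[RHS]oppr0 -{}est; ring.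
- by rewrite -ests; ring.
Qed.

(** Algebraic independence of s and t over K. *)
Definition generic s t := forall p, ev c s t p = 0 -> p = 0.

Lemma coef_id_mul w s t : s != t -> coef_id ((u - v) * w) s t = ev c s t w.
Proof.
move=> st; rewrite !(coef_id.unlock, coef_sw.unlock, mirror.unlock) rmorphM rmorphB /= evX0 evX1 mulrC mulKf //.
by rewrite subr_eq0.
Qed.

Lemma coef_sw0 s t : coef_sw 0 s t = 0.
Proof. by rewrite !(coef_id.unlock, coef_sw.unlock, mirror.unlock) rmorph0 mul0r oppr0. Qed.

Lemma coef_sw_eq0 q s t : s != t -> (coef_sw q s t == 0) = (ev c s t q == 0).
Proof. by move=> st; rewrite !(coef_id.unlock, coef_sw.unlock, mirror.unlock) oppr_eq0 mulf_eq0 invr_eq0 subr_eq0 (negPf st) orbF. Qed.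

Lemma coef_id_eq0 q s t : s != t -> (coef_id q s t == 0) = (ev c s t q == 0).
Proof. by move=> st; rewrite !(coef_id.unlock, coef_sw.unlock, mirror.unlock) mulf_eq0 invr_eq0 subr_eq0 (negPf st) orbF. Qed.

Lemma generic_neq s t : generic s t -> s != t.
Proof.
move=> g; apply/eqP => st.
have /g/eqP : ev c s t (u - v) = 0 by rewrite rmorphB /= evX0 evX1 st subrr.
apply/negP; rewrite subr_eq0; apply/eqP => /(congr1 (mcoeff U_(ord0)%MM)).
by rewrite !mcoeffXU; apply/eqP; rewrite oner_eq0.
Qed.

Lemma generic_ev_neq0 s t p : generic s t -> p != 0 -> ev c s t p != 0.
Proof. by move=> g; apply: contra_neq => /g. Qed.

(** Since t is transcendental over K, no nonzero coefficient in K[v] vanishes at v = t, so the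
    degree in u survives. *)
Lemma size_ev_fst s t p : generic s t -> size (ev_fst c t p) = size (to_poly p).
Proof.
move=> g; apply: size_map_inj_poly; last by rewrite !rmorph0.
apply: raddf_inj => q q0; have: ev c s t (of_poly q%:P) = 0.
  by rewrite ev_fstE /ev_fst /= of_polyK map_polyC hornerC.
by move/g/(congr1 (@to_poly K)); rewrite of_polyK rmorph0 => /polyC_inj.
Qed.

Definition indep w := (size (to_poly w) <= 1)%N.

Lemma indepP (A : comNzRingType) (d : {rmorphism K -> A}) s s' t w :
  indep w -> ev d s t w = ev d s' t w.
Proof. by move/size1_polyC => ew; rewrite !ev_fstE /ev_fst /= ew map_polyC !hornerC. Qed.

Lemma indep_const w w' : indep w -> indep w' -> w = sw w' -> exists a, w = a%:MP.
Proof.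
move=> iw iw' ww'; exists (ev (@idfun K) 0 0 w').
have -> : (ev idfun 0 0 w')%:MP = ev (@mpolyC 2 K) 0 0 w'.
  by apply: (ev_rmorph (g := @mpolyC 2 K)) => a.
rewrite -[LHS]ev_id (indepP _ _ 0 _ iw) ww' ev_sw.
rewrite (indepP _ _ 0 _ iw') //.
Qed.

(** The first clause says that the operator sends 1 to a polynomial, the second that it is not
    zero. *)
Definition good p q := (exists w, p - q = (u - v) * w) /\ ((p != 0) || (q != 0)).

Lemma good_mirror p q : good p q -> good (mirror p) (mirror q).
Proof.
case=> [[w pq] nz]; split; last by rewrite !mirror_eq0.
by exists (sw w); rewrite -mirrorM -pq !mirror.unlock rmorphB; ring.
Qed.

Lemma good0 p : good p 0 -> exists2 w, w != 0 & p = (u - v) * w.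
Proof.
rewrite /good eqxx orbF subr0 => -[[w ->] nz]; exists w => //.
by apply: contraNneq nz => ->; rewrite mulr0.
Qed.

Section Degree.
Variable inf : nat -> L.
Hypothesis inf_inj : injective inf.

(* For q2 <> 0, [braid_t] reads w(x,y) w(x,z) = a w(x,y) + b w(x,z) with a, b free
   of x: the degree in x doubles on the left-hand side only. *)
Lemma scaling_indep y z w p2 q2 : generic y z -> generic z y -> w != 0 ->
  good p2 q2 -> braid_rel ((u - v) * w) 0 p2 q2 -> indep w.
Proof.
move=> gyz gzy nz_w gd br; have yz := generic_neq gyz; have zy := generic_neq gzy.
rewrite /indep; set N := size _.
have N_gt0 : (0 < N)%N.
  by rewrite size_poly_gt0; apply: contra_neq nz_w => w0; rewrite -[w]to_polyK w0 rmorph0.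
pose f := ev_fst c y w; pose g := ev_fst c z w.
have szf : size f = N by apply: size_ev_fst gzy.
have szg : size g = N by apply: size_ev_fst gyz.
have nz_f : f != 0 by rewrite -size_poly_gt0 szf.
have nz_g : g != 0 by rewrite -size_poly_gt0 szg.
have [q0|nz_q] := eqVneq q2 0.
  (* Both operators are multiplications: [braid_1] reads w(x,y)^2 k = k^2 w(x,y), so f equals the
     constant k. *)
  rewrite q0 in gd br; have [w2 nz_w2 ep2] := good0 gd.
  pose k := ev c y z w2; have nz_k : k != 0 by exact: generic_ev_neq0.
  have : (k *: f) * (f - k%:P) = 0.
    apply: (poly_ext (s := [:: y; z]) inf_inj) => x.
    rewrite !inE negb_or => /andP[xy xz].
    have /braid_1 := br x y z xy yz xz.
    rewrite ep2 !coef_id_mul // !coef_sw0 !mul0r !addr0 -/k !ev_fstE -/f => e.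
    have -> : (k *: f * (f - k%:P)).[x] = f.[x] ^+ 2 * k - k ^+ 2 * f.[x].
      by rewrite !hornerE; ring.
    by rewrite e subrr.
  move/eqP; rewrite mulf_eq0 scaler_eq0 (negPf nz_k) (negPf nz_f) subr_eq0 /=.
  by move/eqP => ef; rewrite -szf ef size_polyC leq_b1.
pose al := coef_id p2 y z; pose be := coef_id p2 z y.
have : f * g - (al *: f + be *: g) = 0.
  apply: (poly_ext (s := [:: y; z]) inf_inj) => x.
  rewrite !inE negb_or => /andP[xy xz].
  have /braid_t/eqP := br x y z xy yz xz.
  rewrite mulf_eq0 coef_sw_eq0 // (negPf (generic_ev_neq0 gyz nz_q)) /=.
  rewrite !coef_id_mul // !ev_fstE -/f -/g -/al -/be => /eqP e.
  by rewrite hornerD hornerN hornerM !hornerE -e; ring.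
move/eqP; rewrite subr_eq0 => /eqP/(congr1 (fun h : {poly L} => size h)).
rewrite size_mul // szf szg => e.
have : (size (al *: f + be *: g)%R <= N)%N.
  apply: leq_trans (size_polyD _ _) _; rewrite geq_max.
  by rewrite (leq_trans (size_scale_leq _ _)) ?szf // (leq_trans (size_scale_leq _ _)) ?szg.
rewrite -e; case: (N) N_gt0 => // n _.
by rewrite addSn /= addnS ltnS -[leqRHS]add0n leq_add2r.
Qed.

End Degree.
End FunctionalEquations.

(** * Multiplication operators are constant *)

Section Scalar.
Variables (K L : fieldType) (c : {rmorphism K -> L}) (inf : nat -> L).
Hypothesis inf_inj : injective inf.
Variable G : 'I_4 -> L.
Hypothesis G_generic : forall i j, i != j -> generic c (G i) (G j).

Implicit Types p q w : {mpoly K[2]}.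
Notation u := ('X_ord0 : {mpoly K[2]}).
Notation v := ('X_ord_max : {mpoly K[2]}).
Notation coef_id := (coef_id c).
Notation coef_sw := (coef_sw c).
Notation braid_rel := (braid_rel c).

Lemma G_neq i j : i != j -> G i != G j.
Proof. by move/G_generic/generic_neq. Qed.

Lemma third (i j : 'I_4) : exists k, (k != i) && (k != j).
Proof.
case: (boolP [exists k, (k != i) && (k != j)]) => [/existsP //|].
rewrite negb_exists => /forallP h.
have : [set: 'I_4] \subset [set i; j].
  by apply/subsetP => k _; have := h k; rewrite negb_and !negbK !inE.
by move/subset_leq_card; rewrite cardsT card_ord cards2; case: (_ == _).
Qed.

Lemma eq_generic i j p q : i != j ->
  ev c (G i) (G j) p = ev c (G i) (G j) q -> p = q.
Proof.
move=> ij /eqP; rewrite -subr_eq0 -rmorphB => /eqP/(G_generic ij)/eqP.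
by rewrite subr_eq0 => /eqP.
Qed.

Lemma indep_eq_const i j w : indep w -> i != j ->
  ev c 0 (G i) w = ev c 0 (G j) w -> exists a, w = a%:MP.
Proof.
move=> iw ij e; apply: (indep_const iw iw).
apply: (eq_generic ij); rewrite ev_sw.
by rewrite (indepP c _ 0 _ iw) -e; apply: indepP.
Qed.

(** Eliminating b from the two quadratic equations and using the linear relation leaves r r' (r -
    r') (r + r' - a - a') = 0. The second claim then follows from a (r - r') = (a r + a' r') - (a +
    a') r'. *)
Lemma front_field (F : fieldType) (r r' a a' b : F) : r != 0 -> r' != 0 ->
    a * r + a' * r' = r * r' ->
    r ^+ 2 * a = a ^+ 2 * r + b * r' -> r' ^+ 2 * a' = a' ^+ 2 * r' + b * r ->
    r != r' ->
  a + a' = r + r' /\ a * (r - r') = - r' ^+ 2.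
Proof.
move=> nz_r nz_r' h1 h2 h3 rr'.
have E : a + a' = r + r'.
  apply/eqP; rewrite -subr_eq0; apply/eqP.
  have nz : r * r' * (r' - r) != 0 by rewrite !mulf_neq0 // subr_eq0 eq_sym.
  apply: (mulfI nz); rewrite mulr0.
  have h1' : a * r = r' * (r - a') by rewrite mulrBr [r' * r]mulrC -h1; ring.
  have h1'' : a' * r' = r * (r' - a) by rewrite mulrBr -h1; ring.
  have e1 : b * r * r' = r * (a * r) * (r - a).
    have : b * r' = r ^+ 2 * a - a ^+ 2 * r by rewrite h2; ring.
    by rewrite [b * r * r']mulrAC => ->; ring.
  have e2 : b * r * r' = r' * (a' * r') * (r' - a').
    have : b * r = r' ^+ 2 * a' - a' ^+ 2 * r' by rewrite h3; ring.
    by move=> ->; ring.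
  have e3 : r * (a * r) * (r - a) - r' * (a' * r') * (r' - a') = 0.
    by rewrite -e1 -e2 subrr.
  rewrite -[RHS]e3 h1' h1''; ring.
split=> //.
have -> : a * (r - r') = a * r + a' * r' - (a + a') * r' by ring.
by rewrite h1 E; ring.
Qed.

(** The right neighbour of a multiplication by w = r(x_{i+1}): [braid_t] gives a r_i + a' r_j = r_i
    r_j, and [braid_1] at the point and at its transpose gives the quadratic equations of
    [front_field]. So A of the neighbour is known wherever r takes distinct values. *)
Lemma front w p q i j :
    w != 0 -> indep w -> q != 0 -> i != j ->
    braid_rel ((u - v) * w) 0 p q ->
  let r k := ev c 0 (G k) w in
  let a := coef_id p (G i) (G j) in let a' := coef_id p (G j) (G i) in
  (r i = r j -> a + a' = r i) /\
  (r i != r j -> a + a' = r i + r j /\ a * (r i - r j) = - r j ^+ 2).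
Proof.
move=> nz_w iw nz_q ij br r a a'.
have [k /andP[ki kj]] := third i j.
have ji : j != i by rewrite eq_sym.
have r_neq0 l : r l != 0.
  have [l' /andP[l'l _]] := third l l.
  by rewrite /r (indepP c _ (G l') _ iw); apply: (generic_ev_neq0 (G_generic l'l)).
have rE l l' : ev c (G l') (G l) w = r l by apply: indepP.
have [e1 _ et _ _ _] := br _ _ _ (G_neq ki) (G_neq ij) (G_neq kj).
have [e1' _ _ _ _ _] := br _ _ _ (G_neq kj) (G_neq ji) (G_neq ki).
move: e1 e1' et; rewrite !coef_id_mul ?G_neq // !coef_sw0 !rE -/a -/a' !mul0r !addr0.
move=> e1 e1' /eqP; rewrite mulf_eq0 coef_sw_eq0 ?G_neq //.
rewrite (negPf (generic_ev_neq0 (G_generic ij) nz_q)) /= => /eqP et.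
have h : a * r i + a' * r j = r i * r j.
  by apply/eqP; rewrite -subr_eq0 -oppr_eq0 -et; apply/eqP; ring.
split=> rr.
  by apply: (mulIf (r_neq0 i)); rewrite mulrDl {2}rr h rr.
apply: (front_field (r_neq0 i) (r_neq0 j) h e1 _ rr).
by rewrite e1'; ring.
Qed.

(** The equation [braid_st] is a product of B_1, B_2 and A_1 - A_2, whose first two factors are
    nonzero at generic points. *)
Lemma same_coef_id p1 q1 p2 q2 :
  braid_rel p1 q1 p2 q2 -> q1 != 0 -> q2 != 0 -> p1 = p2.
Proof.
move=> br nz1 nz2; pose i0 := @ord0 3; pose i1 := lift i0 (@ord0 2).
have i01 : i0 != i1 by []. have i02 : i0 != ord_max by [].
have i12 : i1 != ord_max by [].
have [_ _ _ /eqP e _ _] := br _ _ _ (G_neq i01) (G_neq i12) (G_neq i02).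
move: e; rewrite !mulf_eq0 !coef_sw_eq0 ?G_neq // ?(negPf (generic_ev_neq0 (G_generic _) _)) //=.
rewrite !coef_id.unlock -mulrBl -rmorphB mulf_eq0 invr_eq0 subr_eq0 (negPf (G_neq i12)) orbF.
by move/eqP/(G_generic i12)/eqP; rewrite subr_eq0 => /eqP.
Qed.

(** The right neighbour removes u from w and, after mirroring, the left neighbour removes v. *)
Lemma middle_const p0 q0 w p2 q2 : w != 0 -> good p0 q0 -> good p2 q2 ->
    braid_rel p0 q0 ((u - v) * w) 0 -> braid_rel ((u - v) * w) 0 p2 q2 ->
  exists a, w = a%:MP.
Proof.
move=> nz_w g0 g2 /braid_rel_mirror; rewrite mirrorM mirror0 => br0 br2.
have g01 : generic c (G ord0) (G ord_max) by apply: G_generic.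
have g10 : generic c (G ord_max) (G ord0) by apply: G_generic.
apply: (@indep_const _ w (sw w)); last by rewrite swK.
  exact: (scaling_indep inf_inj g01 g10 nz_w g2 br2).
apply: (scaling_indep inf_inj g01 g10 _ (good_mirror g0) br0).
by rewrite sw_eq0.
Qed.

(* If w = r(x_2) were not constant, the equations for the pair (1, 2) would give
   A_2(y,z) = - r(z)^2 / (r(y) - r(z)), which no operator of index 3 allows. *)
Lemma first_const w p2 q2 p3 q3 : w != 0 -> good p2 q2 -> good p3 q3 ->
    braid_rel ((u - v) * w) 0 p2 q2 -> braid_rel p2 q2 p3 q3 ->
  exists a, w = a%:MP.
Proof.
move=> nz_w g2 g3 br2 br3.
have g01 : generic c (G ord0) (G ord_max) by apply: G_generic.
have g10 : generic c (G ord_max) (G ord0) by apply: G_generic.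
have iw : indep w := scaling_indep inf_inj g01 g10 nz_w g2 br2.
pose i0 := @ord0 3; pose i1 : 'I_4 := lift ord0 (@ord0 2).
pose i2 : 'I_4 := lift ord0 (lift ord0 (@ord0 1)).
have i01 : i0 != i1 by []. have i02 : i0 != i2 by [].
have i12 : i1 != i2 by []. have i21 : i2 != i1 by [].
have i20 : i2 != i0 by []. have i10 : i1 != i0 by [].
(* If operator 2 is a multiplication as well, it has neighbours on both sides and is a constant a;
   [braid_1] for the pair (1, 2) then reads w^2 a = a^2 w. *)
have [q20|nz_q2] := eqVneq q2 0.
  rewrite {q2}q20 in g2 br2 br3.
  have [w2 nz_w2 ep2] := good0 g2; rewrite ep2 in g2 br2 br3.
  have gw : good ((u - v) * w) 0.
    split; first by exists w; rewrite subr0.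
    rewrite mulf_neq0 //; apply: contraNneq (generic_neq g01) => uv.
    by rewrite -subr_eq0 -(evX0 c (G ord0) (G ord_max)) -{2}(evX1 c (G ord0) (G ord_max)) -rmorphB uv rmorph0.
  have [a ea] := middle_const nz_w2 gw g3 br2 br3.
  exists a.
  have nz_a : c a != 0.
    by apply: contra_neq nz_w2; rewrite ea => /eqP; rewrite fmorph_eq0 => /eqP->.
  have [e1 _ _ _ _ _] := br2 _ _ _ (G_neq i01) (G_neq i12) (G_neq i02).
  move: e1; rewrite !coef_id_mul ?G_neq // !coef_sw0 !mul0r !addr0 ea !evC => e1.
  apply: (eq_generic i01); rewrite evC.
  have nz : ev c (G i0) (G i1) w * c a != 0.
    by rewrite mulf_neq0 // (generic_ev_neq0 (G_generic i01)).
  apply: (mulfI nz); have -> : forall b d : L, b * d * b = b ^+ 2 * d by move=> b d; ring.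
  by rewrite e1; ring.
pose r k := ev c 0 (G k) w.
have [rr|rr] := boolP [exists i, exists j, (i != j) && (r i == r j)].
  have /existsP[i /existsP[j /andP[ij /eqP rij]]] := rr.
  exact: (indep_eq_const iw ij rij).
have {rr} r_neq i j : i != j -> r i != r j.
  by move: rr; rewrite negb_exists => /forallP/(_ i); rewrite negb_exists =>
    /forallP/(_ j); rewrite negb_and => /orP[/negP|].
exfalso.
have F i j : i != j -> coef_id p2 (G i) (G j) + coef_id p2 (G j) (G i) = r i + r j /\
    coef_id p2 (G i) (G j) * (r i - r j) = - r j ^+ 2.
  by move=> ij; apply: (front nz_w iw nz_q2 ij br2).2; apply: r_neq.
(* If operator 3 is a multiplication too, the mirrored [front] describes A_2 a second time, with
   values s in place of r, and the two descriptions are compared. *)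
have [q30|nz_q3] := eqVneq q3 0.
  rewrite {q3}q30 in g3 br3.
  have [w3 nz_w3 ep3] := good0 g3; rewrite ep3 in br3.
  have br3' := braid_rel_mirror br3; rewrite mirrorM mirror0 in br3'.
  have nz_w3' : sw w3 != 0 by rewrite sw_eq0.
  have nz_q2' : mirror q2 != 0 by rewrite mirror_eq0.
  have iw3 := scaling_indep inf_inj g01 g10 nz_w3' (good_mirror g2) br3'.
  pose s k := ev c 0 (G k) (sw w3).
  have F' i j (ij : i != j) := front nz_w3' iw3 nz_q2' ij br3'.
  have [ss|ss] := boolP [exists i, exists j, (i != j) && (s i == s j)].
    have /existsP[i /existsP[j /andP[ij /eqP sij]]] := ss.
    have [a ea] := indep_eq_const iw3 ij sij.
    have sE k l : k != l -> r k + r l = c a.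
      move=> kl; have [<- _] := F _ _ kl; rewrite addrC.
      have [] := F' _ _ kl; rewrite !coef_id_mirror ea !evC => h _; exact: h.
    have : r i0 + r i1 = r i0 + r i2 by rewrite !sE.
    by move/addrI/eqP; apply/negP/r_neq.
  have {ss} s_neq i j : i != j -> s i != s j.
    by move: ss; rewrite negb_exists => /forallP/(_ i); rewrite negb_exists =>
      /forallP/(_ j); rewrite negb_and => /orP[/negP|].
  have sum_rs i j : i != j -> r i + r j = s i + s j.
    move=> ij; have [<- _] := F _ _ ij; have [_ /(_ (s_neq _ _ ij)) [<- _]] := F' _ _ ij.
    by rewrite !coef_id_mirror addrC.
  have diff_rs i j : r i - r j = s i - s j.
    have [k /andP[ki kj]] := third i j.
    have -> : r i - r j = (r k + r i) - (r k + r j) by ring.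
    by rewrite !sum_rs //; ring.
  (* Both closed forms of A_2(G j, G i) have the same denominator up to sign, so their numerators
     can be equated. Then r_i^2 = r_j^2 for all i and j, too few values for three distinct r. *)
  have sqr_rs i j : i != j -> r i ^+ 2 = - s j ^+ 2.
    move=> ij; have ji : j != i by rewrite eq_sym.
    have [_ e] := F _ _ ji; have [_ /(_ (s_neq _ _ ij)) [_]] := F' _ _ ij.
    by rewrite !coef_id_mirror -/(s i) -/(s j) -diff_rs => <-; rewrite -[LHS]opprK -e; ring.
  have opp_r i j : i != j -> r i = - r j.
    move=> ij; have [k /andP[ki kj]] := third i j.
    have : (r i - r j) * (r i + r j) = 0.
      by rewrite -subr_sqr (sqr_rs i k) 1?eq_sym // (sqr_rs j k) 1?eq_sym // subrr.
    by move/eqP; rewrite mulf_eq0 subr_eq0 (negPf (r_neq _ _ ij)) addr_eq0 => /eqP.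
  by have := r_neq _ _ i12; rewrite -[r i1]opprK -(opp_r _ _ i01) -[r i2]opprK
    -(opp_r _ _ i02) eqxx.
(* Now A_3 = A_2, and inserting the closed form into [braid_s] leaves r_2^2 times the Vandermonde
   product of r_0, r_1, r_2. *)
have e23 := same_coef_id br3 nz_q2 nz_q3; rewrite -e23 in br3.
have [_ /eqP e _ _ _ _] := br3 _ _ _ (G_neq i01) (G_neq i12) (G_neq i02).
move: e; rewrite mulf_eq0 coef_sw_eq0 ?G_neq // (negPf (generic_ev_neq0 (G_generic i01) nz_q2)) /=.
have [_ F01] := F _ _ i01; have [_ F10] := F _ _ i10.
have [_ F12] := F _ _ i12; have [_ F02] := F _ _ i02.
set a01 := coef_id p2 (G i0) (G i1) in F01 *; set a10 := coef_id p2 (G i1) (G i0) in F10 *.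
set a12 := coef_id p2 (G i1) (G i2) in F12 *; set a02 := coef_id p2 (G i0) (G i2) in F02 *.
move=> /eqP e.
have nz_r2 : r i2 != 0.
  by rewrite /r (indepP c _ (G i0) _ iw) (generic_ev_neq0 (G_generic i02)).
have : r i2 ^+ 2 * (r i0 - r i1) * (r i0 - r i2) * (r i1 - r i2) = 0.
  have E0 : - (a01 * (r i0 - r i1)) * (a12 * (r i1 - r i2)) * (r i0 - r i2)
      + (a02 * (r i0 - r i2)) * (a10 * (r i1 - r i0)) * (r i1 - r i2)
      + (a12 * (r i1 - r i2)) * (a02 * (r i0 - r i2)) * (r i0 - r i1) = 0.
    by rewrite -[RHS](mulr0 (- (r i0 - r i1) * (r i0 - r i2) * (r i1 - r i2))) -e; ring.
  by move: E0; rewrite F01 F12 F02 F10 => E0; rewrite -[RHS]E0; ring.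
by move/eqP; rewrite !mulf_eq0 !subr_eq0 (negPf nz_r2)
  (negPf (r_neq _ _ i01)) (negPf (r_neq _ _ i02)) (negPf (r_neq _ _ i12)).
Qed.

End Scalar.

(** * Polynomials of degree at most one in each variable *)

Section Bilinear.
Variable K : fieldType.
Implicit Types p q w : {mpoly K[2]}.
Notation u := ('X_ord0 : {mpoly K[2]}).
Notation v := ('X_ord_max : {mpoly K[2]}).

Lemma subXX_neq0 : u - v != 0.
Proof.
rewrite subr_eq0; apply/eqP => /(congr1 (mcoeff U_(ord0)%MM)).
by rewrite !mcoeffXU; apply/eqP; rewrite oner_eq0.
Qed.

Definition bilin_poly (a b c d : K) : {mpoly K[2]} :=
  a *: (u * v) + b *: u + c *: v + d%:MP.

Lemma ev_bilin_poly (A : comNzRingType) (e : {rmorphism K -> A}) s t a b c d :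
  ev e s t (bilin_poly a b c d) = e a * (s * t) + e b * s + e c * t + e d.
Proof. by rewrite !rmorphD /= !evZ rmorphM /= !evX0 !evX1 evC. Qed.

Lemma sw_bilin_poly a b c d : sw (bilin_poly a b c d) = bilin_poly a c b d.
Proof.
by rewrite sw.unlock ev_bilin_poly /bilin_poly -!mul_mpolyC; ring.
Qed.

Lemma bilin_polyP p : (size (to_poly p) <= 2)%N -> (size (to_poly (sw p)) <= 2)%N ->
  exists a b c d, p = bilin_poly a b c d.
Proof.
have size2 (q : {poly {poly K}}) : (size q <= 2)%N -> q = q`_1 *: 'X + (q`_0)%:P.
  move=> q2; apply/polyP => -[|[|k]]; rewrite !coefE ?(mulr0, mulr1, add0r, addr0) //.
  by rewrite nth_default // (leq_trans q2).
move=> p2 /size2; set f := to_poly _ => ef.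
pose d k : {poly {poly K}} := map_poly polyC f`_k.
have sw_of (q : {poly K}) : sw (of_poly q%:P) = of_poly (map_poly polyC q).
  rewrite of_polyC -horner_map /= swX1 -map_poly_comp of_poly.unlock /=.
  rewrite -map_poly_comp /horner_eval; congr (_.[_]); apply: eq_map_poly => a /=.
  by rewrite swC map_polyC /horner_eval /= hornerC.
have ep : to_poly p = d 1 * 'X%:P + d 0.
  apply: (can_inj (@of_polyK K)); rewrite to_polyK -[p]swK -[sw p]to_polyK -/f ef.
  rewrite -mul_polyC !rmorphD !rmorphM /= !sw_of; congr (_ * _ + _).
  by rewrite of_polyX swX0 of_polyC map_polyX hornerX.
have epk k : (to_poly p)`_k = f`_1`_k *: 'X + (f`_0`_k)%:P.
  by rewrite ep coefD coefMC !coef_map /= mul_polyC.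
exists f`_1`_1, f`_0`_1, f`_1`_0, f`_0`_0.
rewrite -[p]to_polyK (size2 _ p2) !epk -mul_polyC !rmorphD !rmorphM /=.
rewrite -!mul_polyC !rmorphD !rmorphM /= !(of_polyX, of_polyC) !(map_polyC, map_polyX).
by rewrite !(hornerC, hornerX) /bilin_poly -!mul_mpolyC /=; ring.
Qed.

End Bilinear.

(** * From one operator to its neighbour *)

Section Propagation.
Variables (K L : fieldType) (c : {rmorphism K -> L}) (inf : nat -> L).
Hypothesis inf_inj : injective inf.
Variable G : 'I_4 -> L.
Hypothesis G_generic : forall i j, i != j -> generic c (G i) (G j).

Implicit Types p q w : {mpoly K[2]}.
Notation u := ('X_ord0 : {mpoly K[2]}).
Notation v := ('X_ord_max : {mpoly K[2]}).
Notation coef_id := (coef_id c).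
Notation coef_sw := (coef_sw c).
Notation braid_rel := (braid_rel c).

Lemma last_const p0 q0 p1 q1 w : w != 0 -> good p0 q0 -> good p1 q1 ->
    braid_rel p0 q0 p1 q1 -> braid_rel p1 q1 ((u - v) * w) 0 ->
  exists a, w = a%:MP.
Proof.
move=> nz_w /good_mirror g0 /good_mirror g1 /braid_rel_mirror br0 /braid_rel_mirror.
rewrite mirrorM mirror0 => br1.
have nz_sw : sw w != 0 by rewrite sw_eq0.
have [a ea] := first_const inf_inj G_generic nz_sw g1 g0 br1 br0.
by exists a; rewrite -[w]swK ea swC.
Qed.

Lemma coef_id_sum s t p (m : K) : generic c s t -> 
  coef_id p s t + coef_id p t s = c m <-> p - sw p = (u - v) * m%:MP.
Proof.
move=> g; have st := generic_neq g; have nz : s - t != 0 by rewrite subr_eq0.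
have -> : coef_id p s t + coef_id p t s = ev c s t (p - sw p) / (s - t).
  by rewrite !coef_id.unlock rmorphB /= ev_sw -(opprB s t) invrN mulrN mulrBl.
split=> [e|->]; last by rewrite rmorphM rmorphB /= evX0 evX1 evC mulrAC divff // mul1r.
apply/eqP; rewrite -subr_eq0; apply/eqP/g.
by rewrite rmorphB /= -[ev c s t (p - sw p)](divfK nz) e rmorphM rmorphB /= evX0 evX1 evC mulrC subrr.
Qed.

Lemma coef_prod s t p q : generic c s t ->
  coef_id p s t * coef_id p t s = coef_sw q s t * coef_sw q t s <->
  p * sw p = q * sw q.
Proof.
move=> g; have st := generic_neq g; have nz : s - t != 0 by rewrite subr_eq0.
have nz' : - (s - t) ^- 2 != 0 by rewrite oppr_eq0 invr_eq0 expf_neq0.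
have -> : coef_id p s t * coef_id p t s = - (s - t) ^- 2 * ev c s t (p * sw p).
  by rewrite !coef_id.unlock rmorphM /= ev_sw -(opprB s t) invrN; field.
have -> : coef_sw q s t * coef_sw q t s = - (s - t) ^- 2 * ev c s t (q * sw q).
  by rewrite !coef_sw.unlock rmorphM /= ev_sw -(opprB s t) invrN; field.
split=> [/(mulfI nz') e|-> //].
by apply/eqP; rewrite -subr_eq0; apply/eqP/g; rewrite rmorphB /= e subrr.
Qed.

(** With denominators cleared: A(x,y) + A(y,x) = m and A(x,y) A(y,x) = B(x,y) B(y,x), the conditions
    that produce pi^2 = m pi. *)
Definition hecke_pair (m : K) p q :=
  p - sw p = (u - v) * m%:MP /\ p * sw p = q * sw q.

(** The scalar operator m Id needs its own clause: its p has p - s p = 2m (u - v), which violates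
    [hecke_pair] for nonzero m. *)
Definition op_type (m : K) p q :=
  if q == 0 then p = (u - v) * m%:MP else hecke_pair m p q.

Lemma hecke_pair_mirror m p q :
  hecke_pair m p q -> hecke_pair m (mirror p) (mirror q).
Proof.
case=> h1 h2; rewrite /hecke_pair !mirror.unlock !rmorphN /= !swK.
by split; [rewrite -h1; ring | rewrite !mulrNN mulrC h2 mulrC].
Qed.

Lemma op_type_mirror m p q : op_type m p q -> op_type m (mirror p) (mirror q).
Proof.
rewrite /op_type mirror_eq0; case: ifP => _; last exact: hecke_pair_mirror.
by move=> ->; rewrite mirrorM swC.
Qed.

(** Four cases. Two scalars agree by [braid_1]. After a scalar, [braid_t] gives the sum A(y,z) +
    A(z,y) = m and [braid_1] the product. Before a scalar, [braid_s] identifies that scalar with the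
    sum, hence with m. Two non-scalar operators share p, so only the product has to be carried
    over. *)
Lemma op_type_next m p1 q1 p2 q2 : good p1 q1 -> good p2 q2 ->
    (q2 = 0 -> exists a, p2 = (u - v) * a%:MP) ->
    braid_rel p1 q1 p2 q2 -> op_type m p1 q1 -> op_type m p2 q2.
Proof.
move=> g1 g2 sc2 br; rewrite /op_type.
pose i0 := @ord0 3; pose i1 : 'I_4 := lift ord0 (@ord0 2).
pose i2 : 'I_4 := lift ord0 (lift ord0 (@ord0 1)).
have i01 : i0 != i1 by []. have i02 : i0 != i2 by [].
have i12 : i1 != i2 by []. have i21 : i2 != i1 by [].
have [e1 es et _ _ _] := br _ _ _ (G_neq G_generic i01) (G_neq G_generic i12) (G_neq G_generic i02).
have nzm a q : good ((u - v) * a%:MP) q -> q = 0 -> c a != 0.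
  move=> [_ nz] q0; move: nz; rewrite q0 eqxx orbF; apply: contraNneq => /eqP.
  by rewrite fmorph_eq0 => /eqP->; rewrite mpolyC0 mulr0.
case: eqP => [q10 ep1|/eqP nz1 [h1 h2]]; case: eqP => [q20|/eqP nz2].
- have [a ea] := sc2 q20; subst p1 q1 p2 q2.
  have nz_a := nzm _ _ g2 erefl; have nz_m := nzm _ _ g1 erefl.
  move: e1; rewrite !coef_id_mul ?(G_neq G_generic) // !coef_sw0 !mul0r !addr0 !evC => e.
  have : c m * c a * (c m - c a) = 0.
    have -> : c m * c a * (c m - c a) = c m ^+ 2 * c a - c a ^+ 2 * c m by ring.
    by rewrite e subrr.
  move/eqP; rewrite !mulf_eq0 (negPf nz_a) (negPf nz_m) -rmorphB fmorph_eq0 subr_eq0.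
  by move/eqP->.
- subst p1 q1; have nz_m := nzm _ _ g1 erefl.
  move: e1 et; rewrite !coef_id_mul ?(G_neq G_generic) // !coef_sw0 !mul0r !addr0 !evC => e1 /eqP.
  rewrite mulf_eq0 coef_sw_eq0 ?(G_neq G_generic) // (negPf (generic_ev_neq0 (G_generic i12) nz2)) /= => /eqP et.
  have E : coef_id p2 (G i1) (G i2) + coef_id p2 (G i2) (G i1) = c m.
    by apply: (mulfI nz_m); rewrite -[RHS]subr0 -et; ring.
  split; first exact/(coef_id_sum _ _ (G_generic i12)).
  apply/(coef_prod _ _ (G_generic i12)); apply: (mulIf nz_m).
  have -> : coef_id p2 (G i2) (G i1) = c m - coef_id p2 (G i1) (G i2) by rewrite -E; ring.
  transitivity (c m ^+ 2 * coef_id p2 (G i1) (G i2) - coef_id p2 (G i1) (G i2) ^+ 2 * c m).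
    by ring.
  by rewrite e1; ring.
- have [a ea] := sc2 q20; subst p2 q2.
  move: es; rewrite !coef_id_mul ?(G_neq G_generic) // !evC => /eqP; rewrite mulf_eq0 coef_sw_eq0 ?(G_neq G_generic) //.
  rewrite (negPf (generic_ev_neq0 (G_generic i01) nz1)) /=.
  move/eqP => e; have nz_a : c a != 0 by apply: (nzm _ _ g2 erefl).
  have /(coef_id_sum _ _ (G_generic i01)) h1' := h1.
  suff /fmorph_inj -> : c m = c a by [].
  by apply: (mulfI nz_a); rewrite -h1' -[RHS]addr0 -e; ring.
- have e12 := same_coef_id G_generic br nz1 nz2; rewrite -e12 in es et e1 *.
  split=> //; apply/(coef_prod _ _ (G_generic i12)).
  have /(coef_prod _ _ (G_generic i01)) h2' := h2.
  have nz_p1 : p1 != 0.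
    apply: contraNneq nz1 => p0; move/esym/eqP: h2; rewrite p0 mul0r mulf_eq0 sw_eq0.
    by rewrite orbb.
  have nzA : coef_id p1 (G i0) (G i2) != 0.
    by rewrite coef_id_eq0 ?(G_neq G_generic) // (generic_ev_neq0 (G_generic i02)).
  move: es et => /eqP + /eqP; rewrite !mulf_eq0 !coef_sw_eq0 ?(G_neq G_generic) //.
  rewrite (negPf (generic_ev_neq0 (G_generic i01) nz1)) /= => /eqP es.
  rewrite (negPf (generic_ev_neq0 (G_generic i12) nz2)) /= => /eqP et.
  apply: (mulIf nzA); apply/eqP; rewrite -subr_eq0; apply/eqP.
  move/eqP: e1; rewrite -subr_eq0 -h2' => /eqP e1.
  pose a i j := coef_id p1 (G i) (G j).
  (* Subtracting A(x,y) times [braid_s] and A(y,z) times [braid_t] from [braid_1] leaves A(x,z)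
     times the wanted identity. *)
  have lin (x y z k l : L) : x = 0 -> y = 0 -> z = 0 -> x - k * y - l * z = 0.
    by move=> -> -> ->; ring.
  by rewrite -[RHS](lin _ _ _ (a i0 i1) (a i1 i2) e1 es et) /a; ring.
Qed.

(** For equal p, [braid_t] cleared of denominators is f g = al f (X - z) + be g (X - y). Comparing
    sizes gives 2N - 1 <= N + 1. *)
Lemma braid_size p q1 q2 : q2 != 0 -> p != 0 -> braid_rel p q1 p q2 ->
  (size (to_poly p) <= 2)%N.
Proof.
move=> nz_q nz_p br; set N := size _.
pose i1 : 'I_4 := ord0; pose i2 : 'I_4 := ord_max.
have i12 : i1 != i2 by []. have i21 : i2 != i1 by [].
pose y := G i1; pose z := G i2.
have yz : y != z := G_neq G_generic i12.
have zy : z != y := G_neq G_generic i21.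
have N_gt0 : (0 < N)%N.
  by rewrite size_poly_gt0; apply: contra_neq nz_p => p0; rewrite -[p]to_polyK p0 rmorph0.
pose f := ev_fst c y p; pose g := ev_fst c z p.
have szf : size f = N by apply: size_ev_fst (G_generic i21).
have szg : size g = N by apply: size_ev_fst (G_generic i12).
have nz_f : f != 0 by rewrite -size_poly_gt0 szf.
have nz_g : g != 0 by rewrite -size_poly_gt0 szg.
pose al := coef_id p y z; pose be := coef_id p z y.
have : f * g - (al *: (f * ('X - z%:P)) + be *: (g * ('X - y%:P))) = 0.
  apply: (poly_ext (s := [:: y; z]) inf_inj) => x.
  rewrite !inE negb_or => /andP[xy xz].
  have /braid_t/eqP := br x y z xy yz xz.
  rewrite mulf_eq0 coef_sw_eq0 // (negPf (generic_ev_neq0 (G_generic i12) nz_q)) /=.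
  rewrite -/al -/be {1 2 3 4}coef_id.unlock !ev_fstE -/f -/g => /eqP e.
  have xy0 : x - y != 0 by rewrite subr_eq0.
  have xz0 : x - z != 0 by rewrite subr_eq0.
  rewrite !(hornerD, hornerN, hornerZ, hornerM, hornerX, hornerC) -[RHS](mulr0 ((x - y) * (x - z))) -e; field.
  by rewrite xy0 xz0.
move/eqP; rewrite subr_eq0 => /eqP/(congr1 (fun h : {poly L} => size h)).
rewrite size_mul // szf szg => e.
have : (size (al *: (f * ('X - z%:P)) + be *: (g * ('X - y%:P)))%R <= N.+1)%N.
  apply: leq_trans (size_polyD _ _) _; rewrite geq_max.
  rewrite (leq_trans (size_scale_leq _ _)) ?size_Mmonic ?monicXsubC ?size_XsubC ?szf ?addn2 //.
  by rewrite (leq_trans (size_scale_leq _ _)) ?size_Mmonic ?monicXsubC ?size_XsubC ?szg ?addn2.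
rewrite -e; case: (N) N_gt0 => // n _.
by rewrite addSn /= -[n.+2]addn2 leq_add2l.
Qed.

(** [braid_size] and its mirror bound the degrees in u and in v; for a bilinear p the bracket in
    [braid_t] is the constant -(ad - bc). *)
Lemma braid_bilinear m p q1 q2 : q1 != 0 -> q2 != 0 -> p != 0 ->
    braid_rel p q1 p q2 -> p - sw p = (u - v) * m%:MP ->
  exists a b c d, [/\ p = bilin_poly a b c d, a * d - b * c = 0 & b - c = m].
Proof.
move=> nz_q1 nz_q2 nz_p br pm.
have p2 := braid_size nz_q2 nz_p br.
have p2' : (size (to_poly (sw p)) <= 2)%N.
  have em : mirror p = - sw p by rewrite mirror.unlock.
  rewrite -size_polyN -rmorphN /= -em.
  by apply: (braid_size _ _ (braid_rel_mirror br)); rewrite mirror_eq0.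
have [a [b [e [d ep]]]] := bilin_polyP p2 p2'; exists a, b, e, d; split=> //.
  pose i0 := @ord0 3; pose i1 : 'I_4 := lift ord0 (@ord0 2).
  pose i2 : 'I_4 := lift ord0 (lift ord0 (@ord0 1)).
  have i01 : i0 != i1 by []. have i02 : i0 != i2 by [].
  have i12 : i1 != i2 by [].
  have [_ _ /eqP et _ _ _] := br _ _ _ (G_neq G_generic i01) (G_neq G_generic i12) (G_neq G_generic i02).
  move: et; rewrite mulf_eq0 coef_sw_eq0 ?(G_neq G_generic) //.
  rewrite (negPf (generic_ev_neq0 (G_generic i12) nz_q2)) /= ep.
  rewrite !coef_id.unlock !ev_bilin_poly => /eqP et.
  have d01 : G i0 - G i1 != 0 by rewrite subr_eq0 (G_neq G_generic).
  have d02 : G i0 - G i2 != 0 by rewrite subr_eq0 (G_neq G_generic).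
  have d12 : G i1 - G i2 != 0 by rewrite subr_eq0 (G_neq G_generic).
  have d21 : G i2 - G i1 != 0 by rewrite subr_eq0 eq_sym (G_neq G_generic).
  have /eqP : c (a * d - b * e) = 0; last by rewrite fmorph_eq0 => /eqP.
  rewrite -[RHS]oppr0 -et rmorphB !rmorphM /=; field.
  by rewrite d01 d02 d12 d21.
apply/eqP; rewrite -subr_eq0 -(mpolyC_eq0 2); apply/eqP.
apply: (mulfI (subXX_neq0 K)); rewrite mulr0 mpolyCB mulrBr -pm ep sw_bilin_poly.
by rewrite /bilin_poly -!mul_mpolyC !mpolyCB; ring.
Qed.

End Propagation.

(** * Factorizations *)

Section Factorization.
Variable K : fieldType.
Implicit Types p q w : {mpoly K[2]}.
Notation u := ('X_ord0 : {mpoly K[2]}).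
Notation v := ('X_ord_max : {mpoly K[2]}).

(** A 2 x 2 matrix of determinant zero is a column (al, be) times a row (ga, de). The bilinear
    polynomial with these coefficients is therefore (al u + be)(ga v + de). *)
Lemma rank1 (a b c d : K) : a * d - b * c = 0 ->
  exists al be ga de, [/\ a = al * ga, b = al * de, c = be * ga & d = be * de].
Proof.
have [->|nz_a] := eqVneq a 0.
  rewrite mul0r sub0r => /eqP; rewrite oppr_eq0 mulf_eq0 => /orP[/eqP-> | /eqP->].
    by exists 0, 1, c, d; rewrite !(mul0r, mul1r).
  by exists b, d, 0, 1; rewrite !(mulr0, mulr1).
move/eqP; rewrite subr_eq0 => /eqP e; exists a, c, 1, (b / a).
by rewrite !mulr1; split=> //; [field | apply: (mulfI nz_a); rewrite e; field].
Qed.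

Definition lin (al be : K) p : {mpoly K[2]} := al *: p + be%:MP.

(** The candidates for q when p = (al u + be)(ga v + de): each factor independently keeps or
    exchanges its variable. *)
Definition lin_product (al be ga de : K) q :=
  [\/ q = lin al be v * lin ga de u, q = lin al be u * lin ga de v,
      q = lin al be v * lin ga de v | q = lin al be u * lin ga de u].

Lemma ev_lin (A : comNzRingType) (e : {rmorphism K -> A}) s t al be p :
  ev e s t (lin al be p) = e al * ev e s t p + e be.
Proof. by rewrite rmorphD /= evZ evC. Qed.

Lemma sw_lin al be p : sw (lin al be p) = lin al be (sw p).
Proof. by rewrite rmorphD /= swZ swC. Qed.

Lemma bilin_poly_lin al be ga de :
  bilin_poly (al * ga) (al * de) (be * ga) (be * de) = lin al be u * lin ga de v.
Proof. by rewrite /bilin_poly /lin -!mul_mpolyC !mpolyCM; ring. Qed.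

Lemma lin_neq0 al be : (al, be) != (0, 0) -> lin al be u != 0.
Proof.
apply: contraNneq => e.
have: ev (@idfun K) 0 0 (lin al be u) = 0 by rewrite e rmorph0.
have: ev (@idfun K) 1 0 (lin al be u) = 0 by rewrite e rmorph0.
by rewrite !ev_lin !evX0 /= mulr1 mulr0 add0r => + e0; rewrite e0 addr0 => ->.
Qed.

Lemma root_factor q (r : K) :
  ev polyC r%:P 'X q = 0 -> exists q1, q = (u - r%:MP) * q1.
Proof.
rewrite -(evE (f := horner_eval r%:P \o to_poly) (c := polyC)) /=; first last.
- by rewrite to_poly.unlock evX1 /horner_eval hornerC.
- by rewrite to_poly.unlock evX0 /horner_eval hornerX.
- by move=> a; rewrite to_poly.unlock evC /horner_eval /= hornerC.
move/eqP/factor_theorem => [q1 e]; exists (of_poly q1).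
by rewrite -[q]to_polyK e rmorphM rmorphB /= of_polyX of_polyC map_polyC hornerC mulrC.
Qed.

(** Setting u to the root of the linear factor shows that the factor divides q or s q; in the second
    case its swap divides q. For al = 0 the factor is an invertible constant. *)
Lemma lin_split q w al be : (al, be) != (0, 0) ->
    q * sw q = lin al be u * lin al be v * w ->
  exists q1, (q = lin al be u * q1 \/ q = lin al be v * q1) /\ q1 * sw q1 = w.
Proof.
move=> nz e.
have nzu : lin al be u != 0 by apply: lin_neq0.
have nzv : lin al be v != 0 by rewrite -swX0 -sw_lin sw_eq0.
have sw_lin_u : sw (lin al be u) = lin al be v by rewrite sw_lin swX0.
have sw_lin_v : sw (lin al be v) = lin al be u by rewrite sw_lin swX1.
suff [q1 eq1] : exists q1, q = lin al be u * q1 \/ q = lin al be v * q1.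
  exists q1; split=> //; apply: (mulfI (mulf_neq0 nzu nzv)); rewrite -e.
  by case: eq1 => ->; rewrite rmorphM /= ?sw_lin_u ?sw_lin_v; ring.
have [al0|nz_al] := eqVneq al 0.
  have nz_be : be != 0 by apply: contraNneq nz => ->; rewrite al0.
  exists (be^-1 *: q); left.
  by rewrite /lin al0 scale0r add0r mul_mpolyC scalerA divff // scale1r.
pose r := - (be / al).
have linE p : lin al be p = al%:MP * (p - r%:MP).
  rewrite /lin -mul_mpolyC mulrBr -mpolyCM /r mulrN mulrC -[al * (be / al)]mulrC divfK //.
  by rewrite mpolyCN opprK mulrC.
have div p : ev polyC r%:P 'X p = 0 -> exists p1, p = lin al be u * p1.
  case/root_factor => p1 ->; exists (al^-1 *: p1).
  rewrite linE -mulrA mulrCA -mul_mpolyC; congr (_ * _).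
  by rewrite mulrA -mpolyCM divff // mpolyC1 mul1r.
have : ev polyC r%:P 'X (q * sw q) = 0.
  rewrite e linE !rmorphM rmorphB /= evX0 !evC subrr.
  by rewrite mulr0 !mul0r.
move/eqP; rewrite rmorphM mulf_eq0 => /orP[/eqP/div[q1 ->]|/eqP/div[q1 e1]].
  by exists q1; left.
by exists (sw q1); right; rewrite -[q]swK e1 rmorphM /= sw_lin_u.
Qed.

Lemma mul1_const p q : q * p = 1 -> exists a, p = a%:MP.
Proof. by move/mpoly_intro_unit/andP => [/eqP-> _]; exists (p@_0%MM). Qed.

Lemma good_diag p q : good p q -> ev (@mpolyC 2 K) u u p = ev (@mpolyC 2 K) u u q.
Proof.
case=> [[w e] _]; apply/eqP; rewrite -subr_eq0 -rmorphB e rmorphM rmorphB /=.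
by rewrite evX0 evX1 subrr mul0r.
Qed.

(** Splitting off both linear factors leaves a cofactor whose product with its swap is 1, hence a
    constant k. Since p and q agree on the diagonal u = v, k = 1. *)
Lemma four_factors p q al be ga de :
    (al, be) != (0, 0) -> (ga, de) != (0, 0) -> good p q ->
    p = lin al be u * lin ga de v -> p * sw p = q * sw q ->
  lin_product al be ga de q.
Proof.
move=> nz1 nz2 /good_diag dg ep pq.
have e1 : q * sw q = lin al be u * lin al be v * (lin ga de u * lin ga de v * 1).
  by rewrite -pq ep rmorphM /= !sw_lin swX0 swX1; ring.
have [q1 [eq1 e2]] := lin_split nz1 e1.
have [q2 [eq2]] := lin_split nz2 e2.
rewrite mulrC => /mul1_const[k ek].
suff k1 : k = 1.
  move: eq1 eq2; rewrite ek k1 mpolyC1 !mulr1.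
  by case=> -> [] ->; [constructor 4|constructor 2|constructor 1|constructor 3].
have nzu : lin al be u * lin ga de u != 0 by rewrite mulf_neq0 ?lin_neq0.
have E : ev (@mpolyC 2 K) u u q = lin al be u * lin ga de u * k%:MP.
  by case: eq1 eq2 => -> [] ->; rewrite ek !rmorphM /= !ev_lin ?evX0 ?evX1 evC /lin !mul_mpolyC; ring.
move: dg; rewrite {}E ep rmorphM /= !ev_lin evX0 evX1 !mul_mpolyC -/(lin _ _ _) -/(lin _ _ _).
rewrite -[LHS]mulr1 => /(mulfI nzu)/esym/eqP.
by rewrite -mpolyC1 mpolyC_eq => /eqP.
Qed.

End Factorization.

(** * Coprime factorization in K[v][u] *)

Section JointGauss.
Variable K : fieldType.
Implicit Types (l e : {poly K}) (f g d : {poly {poly K}}).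

Definition dvd_coefs l f := forall i, l %| f`_i.

Lemma dvd_coefsD l f g : dvd_coefs l f -> dvd_coefs l g -> dvd_coefs l (f + g).
Proof. by move=> lf lg i; rewrite coefD dvdp_add. Qed.

Lemma dvd_coefsM l f g : dvd_coefs l g -> dvd_coefs l (f * g).
Proof.
move=> lg i; rewrite coefM; elim/big_ind: _ => [|x y|j _]; first exact: dvdp0.
  exact: dvdp_add.
exact: dvdp_mull.
Qed.

Lemma dvd_coefsN l f : dvd_coefs l f -> dvd_coefs l (- f).
Proof. by move=> lf i; rewrite coefN dvdpNr. Qed.

Lemma dvd_coefsP l f : dvd_coefs l f -> exists g, f = l *: g.
Proof.
move=> lf; exists (map_poly (fun e => e %/ l) f); apply/polyP => i.
by rewrite coefZ coef_map_id0 ?div0p // mulrC divpK.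
Qed.

Lemma dvd_coefsZ l f : dvd_coefs l (l *: f).
Proof. by move=> i; rewrite coefZ dvdp_mulr. Qed.

(** The coefficients of f and g taken together have no common factor, put in the multiplied form
    that applies directly to the coefficients of a product. *)
Definition jointly_primitive f g :=
  forall l e, (forall i, l %| f`_i * e) -> (forall i, l %| g`_i * e) -> l %| e.

(* McCoy's argument modulo l: from the top one down, each coefficient of f kills
   the leading coefficient of d, so the induction on the size of d applies to the multiples f`_i *: d. *)
Lemma jointly_primitive_dvd f g l d : jointly_primitive f g ->
  dvd_coefs l (f * d) -> dvd_coefs l (g * d) -> dvd_coefs l d.
Proof.
move=> fg; elim: {d}(size d) {-2}d (leqnn (size d)) => [|n IHn] d szd lf lg.
  by move: szd; rewrite leqn0 size_poly_eq0 => /eqP-> j; rewrite coef0 dvdp0.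
have coefs m (h : {poly {poly K}}) : (size h <= m)%N -> dvd_coefs l (h * d) ->
    forall i, dvd_coefs l (h`_i *: d).
  elim: m h => [|m IHm] h szh lh i.
    by rewrite (nth_default _ (leq_trans szh _)) // scale0r => j; rewrite coef0 dvdp0.
  pose h' := take_poly m h.
  have hE : h = h' + h`_m *: 'X^m.
    apply/polyP => k; rewrite !coefE; case: ltngtP => [_|mk|->].
    - by rewrite mulr0 addr0.
    - by rewrite mulr0 addr0 nth_default // (leq_trans szh).
    - by rewrite mulr1 add0r.
  have szh' : (size h' <= m)%N by apply: size_take_poly.
  have le : l %| h`_m * d`_n.
    have := lh (m + n)%N; rewrite {1}hE mulrDl coefD -scalerAl coefZ coefXnM.
    rewrite ltnNge leq_addr addKn nth_default ?add0r // (leq_trans (size_polyMleq _ _)) //.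
    by rewrite -subn1 leq_subLR add1n -addnS leq_add.
  have lm : dvd_coefs l (h`_m *: d).
    have dE : h`_m *: d = h`_m *: take_poly n d + (h`_m * d`_n) *: 'X^n.
      apply/polyP => k; rewrite !coefE; case: ltngtP => [_|nk|->].
      - by rewrite mulr0 addr0.
      - by rewrite !mulr0 addr0 (nth_default _ (leq_trans szd nk)) mulr0.
      - by rewrite mulr0 mulr1 add0r.
    have lX : dvd_coefs l ((h`_m * d`_n) *: 'X^n).
      by move=> k; rewrite coefZ dvdp_mulr.
    rewrite dE; apply: (dvd_coefsD _ lX); apply: IHn.
    - by rewrite (leq_trans (size_scale_leq _ _)) // size_take_poly.
    - have -> : f * (h`_m *: take_poly n d) = (h`_m)%:P * (f * d) - f * ((h`_m * d`_n) *: 'X^n).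
        by rewrite mul_polyC scalerAr dE; ring.
      by apply: dvd_coefsD; [|apply: dvd_coefsN]; apply: dvd_coefsM.
    - have -> : g * (h`_m *: take_poly n d) = (h`_m)%:P * (g * d) - g * ((h`_m * d`_n) *: 'X^n).
        by rewrite mul_polyC scalerAr dE; ring.
      by apply: dvd_coefsD; [|apply: dvd_coefsN]; apply: dvd_coefsM.
  have lh' : dvd_coefs l (h' * d).
    have -> : h' * d = h * d - 'X^m * (h`_m *: d).
      by rewrite {1}hE -!mul_polyC; ring.
    by apply: dvd_coefsD => //; apply: dvd_coefsN; apply: dvd_coefsM.
  have [im|im|->] // := ltngtP i m; last first.
    by rewrite nth_default ?scale0r // ?(leq_trans szh) // => j; rewrite coef0 dvdp0.
  have -> : h`_i = h'`_i by rewrite coef_take_poly im.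
  exact: IHm.
by move=> j; apply: fg => i; rewrite -coefZ; apply: (coefs (size _)).
Qed.

Lemma dvd_gcd_seq l e (s : seq {poly K}) : (forall x, x \in s -> l %| e * x) ->
  l %| e * \big[(@gcdp K)/0]_(x <- s) x.
Proof.
elim: s => [|x s IHs] h; first by rewrite big_nil mulr0 dvdp0.
rewrite big_cons (eqp_dvdr _ (mulp_gcdr _ _ _)) dvdp_gcd h ?mem_head // IHs //.
by move=> y ys; apply: h; rewrite inE ys orbT.
Qed.

Lemma gcd_seq_dvd (s : seq {poly K}) x : x \in s -> \big[(@gcdp K)/0]_(y <- s) y %| x.
Proof.
elim: s => // y s IHs; rewrite inE big_cons => /orP[/eqP->|/IHs]; first exact: dvdp_gcdl.
exact: dvdp_trans (dvdp_gcdr _ _).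
Qed.

Lemma primitive_parts f g : f != 0 ->
  exists k f' g', [/\ k != 0, f = k *: f', g = k *: g' & jointly_primitive f' g'].
Proof.
move=> nz_f; pose s : seq {poly K} := polyseq f ++ polyseq g; pose k := \big[(@gcdp K)/0]_(x <- s) x.
have kf : dvd_coefs k f.
  move=> i; have [fi|fi] := ltnP i (size f); last by rewrite nth_default ?dvdp0.
  by apply: gcd_seq_dvd; rewrite mem_cat mem_nth.
have kg : dvd_coefs k g.
  move=> i; have [gi|gi] := ltnP i (size g); last by rewrite nth_default ?dvdp0.
  by apply: gcd_seq_dvd; rewrite mem_cat orbC mem_nth.
have nz_k : k != 0.
  apply: contraNneq nz_f => k0; apply/eqP/polyP => i.
  by have := kf i; rewrite k0 dvd0p coef0 => /eqP.
have [f' ef] := dvd_coefsP kf; have [g' eg] := dvd_coefsP kg.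
exists k, f', g'; split=> // l e lf lg.
rewrite -(dvdp_mul2l _ _ nz_k) [k * e]mulrC; apply: dvd_gcd_seq => x.
rewrite mem_cat => /orP[] /(nthP 0)[i _ <-].
  by rewrite ef coefZ mulrCA dvdp_mul2l // mulrC.
by rewrite eg coefZ mulrCA dvdp_mul2l // mulrC.
Qed.

(** Pseudo-division supplies a gcd only up to factors in K[v]. Dividing the two cofactors by their
    joint content gives f' and g'; if f' d = g' e, then Gauss over the fraction field yields l d =
    g' x and l e = f' x, and [jointly_primitive_dvd] shows that l divides x. The common factor h
    comes from the same claim applied to f and g. *)
Lemma coprime_factors f g : f != 0 -> exists h f' g',
  [/\ f = f' * h, g = g' * h & forall d e : {poly {poly K}}, f' * d = g' * e ->
      exists k, e = f' * k /\ d = g' * k].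
Proof.
move=> nz_f; pose h0 := Pdiv.Idomain.gcdp f g.
have nz_h0 : h0 != 0 by rewrite Pdiv.Idomain.gcdp_eq0 negb_and nz_f.
have := Pdiv.Idomain.divpK (Pdiv.Idomain.dvdp_gcdl f g); rewrite -/h0.
have := Pdiv.Idomain.divpK (Pdiv.Idomain.dvdp_gcdr f g); rewrite -/h0.
set k2 := _ ^+ _; set k1 := _ ^+ _ => e2 e1.
have nz_k1 : k1 != 0 by rewrite expf_neq0 // lead_coef_eq0.
have nz_k2 : k2 != 0 by rewrite expf_neq0 // lead_coef_eq0.
have co : Pdiv.Idomain.coprimep (f %/ h0) (g %/ h0).
  by apply: Pdiv.Idomain.coprimep_div_gcd; rewrite nz_f.
move: e1 e2 co; set a := f %/ h0; set b := g %/ h0 => e1 e2 co.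
have nz_a : a != 0.
  apply: contra_neq nz_f => a0; have /eqP : k1 *: f = 0 by rewrite -e1 a0 mul0r.
  by rewrite scale_poly_eq0 (negPf nz_k1) => /eqP.
have nz_a2 : k2 *: a != 0 by rewrite scale_poly_eq0 negb_or nz_k2.
have [k [f' [g' [nz_k ef eg prim]]]] := primitive_parts (k1 *: b) nz_a2.
have nz_f' : f' != 0 by apply: contraNneq nz_a2 => f0; rewrite ef f0 scaler0.
have fg' : f' * g = g' * f.
  have nz : (k * k1 * k2)%:P != 0 by rewrite polyC_eq0 !mulf_neq0.
  apply: (mulfI nz); rewrite !rmorphM /=.
  have -> : k%:P * k1%:P * k2%:P * (f' * g) = (k *: f') * k1%:P * (k2 *: g).
    by rewrite -!mul_polyC; ring.
  have -> : k%:P * k1%:P * k2%:P * (g' * f) = (k *: g') * k2%:P * (k1 *: f).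
    by rewrite -!mul_polyC; ring.
  by rewrite -ef -eg -e1 -e2 -!mul_polyC; ring.
have claim (d e : {poly {poly K}}) : d * g' = e * f' -> exists x, d = f' * x /\ e = g' * x.
  move=> de.
  have E : d * (k1 *: b) = e * (k2 *: a) by rewrite eg ef -!scalerAr de.
  have /Pdiv.Idomain.dvdpP[[y z] /= nz_y eyz] : Pdiv.Idomain.dvdp a d.
    rewrite -(Pdiv.Idomain.Gauss_dvdpl _ co) -(Pdiv.Idomain.dvdpZr _ _ nz_k1) scalerAr E.
    by rewrite -scalerAr Pdiv.Idomain.dvdpZr // Pdiv.Idomain.dvdp_mull.
  pose l := y * k2; pose x := k *: z.
  have nz_l : l != 0 by rewrite mulf_neq0.
  have h1 : l *: d = f' * x.
    rewrite /l /x mulrC -scalerA eyz scalerAr ef -!scalerAr; congr (_ *: _).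
    by rewrite mulrC.
  have h2 : l *: e = g' * x.
    apply: (mulIf nz_f'); rewrite -scalerAl -de scalerAl h1; ring.
  have : dvd_coefs l x.
    by apply: (jointly_primitive_dvd prim); rewrite -?h1 -?h2; apply: dvd_coefsZ.
  case/dvd_coefsP => t et; exists t.
  have nz_lP : l%:P != 0 by rewrite polyC_eq0.
  by split; apply: (mulfI nz_lP); rewrite mul_polyC ?h1 ?h2 et -mul_polyC; ring.
have /claim[h [efh egh]] : f * g' = g * f' by rewrite mulrC -fg' mulrC.
exists h, f', g'; split=> // d e de.
have /claim[x [-> ->]] : e * g' = d * f' by rewrite mulrC -de mulrC.
by exists x.
Qed.

End JointGauss.

(** * Extracting phi and psi *)

Section HeckeFactor.
Variable K : fieldType.
Implicit Types p q w : {mpoly K[2]}.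
Notation u := ('X_ord0 : {mpoly K[2]}).
Notation v := ('X_ord_max : {mpoly K[2]}).

Lemma diag_factor w : ev (@mpolyC 2 K) u u w = 0 -> exists w1, w = (u - v) * w1.
Proof.
move=> w0; have : (to_poly w).['X] = 0.
  have -> : (to_poly w).['X] = ev polyC 'X 'X w.
    rewrite -(evE (f := horner_eval 'X \o to_poly) (c := polyC)) //=; rewrite to_poly.unlock.
    - by move=> a; rewrite evC /horner_eval /= hornerC.
    - by rewrite evX0 /horner_eval hornerX.
    - by rewrite evX1 /horner_eval hornerC.
  have <- : ev polyC 'X 'X (ev (@mpolyC 2 K) u u w) = ev polyC 'X 'X w.
    rewrite (ev_rmorph (c' := polyC) (g := ev polyC 'X 'X)) => [|a] /=.
      by rewrite evX0.
    by rewrite evC.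
  by rewrite w0 rmorph0.
move/eqP/factor_theorem => [q1 e]; exists (of_poly q1).
by rewrite -[w]to_polyK e rmorphM rmorphB /= of_polyX of_polyC map_polyX hornerX mulrC.
Qed.

(** Write p = f h and q = g h with f, g coprime. Then f (s f) = g (s g), and coprimality forces g =
    s f or g = - s f. The first case gives phi = h and psi = f. *)
Lemma hecke_factor p q : q != 0 -> good p q -> p * sw p = q * sw q ->
  exists phi psi, p = phi * psi /\ q = phi * sw psi.
Proof.
move=> nz_q /good_diag dg pq.
have nz_p : p != 0.
  apply: contraNneq nz_q => p0; move/esym/eqP: pq; rewrite p0 mul0r mulf_eq0 sw_eq0.
  by rewrite orbb.
have nz_to : to_poly p != 0.
  by apply: contra_neq nz_p => p0; rewrite -[p]to_polyK p0 rmorph0.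
have [h0 [f0 [g0 [ef eg co]]]] := coprime_factors (to_poly q) nz_to.
pose h := of_poly h0; pose f := of_poly f0; pose g := of_poly g0.
have {}ef : p = f * h by rewrite -[p]to_polyK ef rmorphM.
have {}eg : q = g * h by rewrite -[q]to_polyK eg rmorphM.
have {}co d e : f * d = g * e -> exists k, e = f * k /\ d = g * k.
  move/(congr1 to_poly); rewrite !rmorphM /= !of_polyK => /co[k [e1 e2]].
  exists (of_poly k); split; apply: (can_inj (@to_polyK K)).
    by rewrite e1 !rmorphM /= !of_polyK.
  by rewrite e2 !rmorphM /= !of_polyK.
have nz_h : h != 0 by apply: contraNneq nz_p => h0'; rewrite ef h0' mulr0.
have nz_f : f != 0 by apply: contraNneq nz_p => f0'; rewrite ef f0' mul0r.
have /co[k [ek1 ek2]] : f * sw f = g * sw g.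
  have nz : h * sw h != 0 by rewrite mulf_neq0 // sw_eq0.
  apply: (mulIf nz); have -> : f * sw f * (h * sw h) = p * sw p by rewrite ef rmorphM /=; ring.
  by rewrite pq eg rmorphM /=; ring.
have eg2 : g = sw f * sw k by rewrite -[g]swK ek1 rmorphM.
have kk : sw k * k = 1.
  have nz : sw f != 0 by rewrite sw_eq0.
  by apply: (mulfI nz); rewrite mulr1 mulrA -eg2.
have [a ea] := mul1_const kk; rewrite ea swC in eg2 kk.
have : a ^+ 2 == 1 by rewrite -(mpolyC_eq 2) rmorphXn /= expr2 kk.
rewrite sqrf_eq1 => /orP[/eqP a1|/eqP a1].
  exists h, f; rewrite ef eg eg2 a1 mpolyC1 mulr1.
  by split; rewrite mulrC.
have {}eg2 : g = - sw f by rewrite eg2 a1 mpolyCN mpolyC1 mulrN1.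
have [two0|nz_two] := eqVneq (2%:R : K) 0.
  exists h, f; rewrite ef eg eg2; split; first exact: mulrC.
  suff -> : - sw f = sw f by rewrite mulrC.
  apply/eqP; rewrite eq_sym -subr_eq0 opprK -mulr2n -scaler_nat.
  by rewrite two0 scale0r.
(* Since p = q on the diagonal, the minus sign makes 2 f h vanish there, so u - v divides f or h.
   Moving this antisymmetric factor between phi and psi absorbs the sign. *)
have : ev (@mpolyC 2 K) u u f * ev (@mpolyC 2 K) u u h = 0.
  have nz2 : (2%:R : K)%:MP_[2] != 0 by rewrite mpolyC_eq0.
  apply: (mulfI nz2); rewrite mulr0.
  move: dg; rewrite ef eg eg2 rmorphM rmorphM rmorphN /= ev_sw => /eqP.
  by rewrite -subr_eq0 mulNr opprK => /eqP <-; rewrite rmorph_nat; ring.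
move/eqP; rewrite mulf_eq0 => /orP[] /eqP/diag_factor[w ew].
  exists (h * (u - v)), w; split; first by rewrite ef ew; ring.
  by rewrite eg eg2 ew rmorphM rmorphB /= swX0 swX1; ring.
exists w, ((u - v) * f); split; first by rewrite ef ew; ring.
by rewrite eg eg2 ew rmorphM rmorphB /= swX0 swX1; ring.
Qed.

End HeckeFactor.

(** * Operators at points *)

HB.lock Definition evn (K : fieldType) (A : comNzRingType) (n : nat)
    (c : {rmorphism K -> A}) (x : 'I_n -> A) (f : {mpoly K[n]}) : A :=
  mmap c x f.
Arguments evn {K A n} c x f.

Section Points.
Variables (K : fieldType) (A : comNzRingType) (n : nat) (c : {rmorphism K -> A}).
Implicit Types (x : 'I_n -> A) (f : {mpoly K[n]}) (i : 'I_n.-1).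

Fact evn_is_zmod_morphism x : zmod_morphism (evn c x).
Proof. by move=> p q; rewrite evn.unlock rmorphB. Qed.

Fact evn_is_monoid_morphism x : monoid_morphism (evn c x).
Proof. by split=> [|p q]; rewrite evn.unlock ?rmorph1 ?rmorphM. Qed.

HB.instance Definition _ x := GRing.isZmodMorphism.Build
  {mpoly K[n]} A (evn c x) (evn_is_zmod_morphism x).
HB.instance Definition _ x := GRing.isMonoidMorphism.Build
  {mpoly K[n]} A (evn c x) (evn_is_monoid_morphism x).

Lemma evnC x a : evn c x a%:MP = c a.
Proof. by rewrite evn.unlock; apply: mmapC. Qed.

Lemma evnX x k : evn c x 'X_k = x k.
Proof. by rewrite evn.unlock mmapX mmap1U. Qed.

Lemma evnZ x a f : evn c x (a *: f) = c a * evn c x f.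
Proof. by rewrite -mul_mpolyC rmorphM /= evnC. Qed.

Lemma eq_evn x y : x =1 y -> evn c x =1 evn c y.
Proof.
move=> xy; apply: mpoly_rmorph_ext => [a|k] /=; first by rewrite !evnC.
by rewrite !evnX xy.
Qed.

Lemma swapX i k : swap i ('X_k : {mpoly K[n]}) = 'X_(tperm (lvar i) (rvar i) k).
Proof. by rewrite /swap /msym mmapX mmap1U. Qed.

Lemma evn_swap x i f : evn c x (swap i f) = evn c (x \o tperm (lvar i) (rvar i)) f.
Proof.
rewrite /swap.
apply: (mpoly_rmorph_ext (f := evn c x \o msym (tperm (lvar i) (rvar i)))
  (g := evn c (x \o tperm (lvar i) (rvar i)))) => [a|k] /=.
  by rewrite /msym mmapC !evnC.
by rewrite -/(swap i 'X_k) swapX !evnX.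
Qed.

End Points.

Section Operators.
Variables (K : fieldType) (n : nat).
Implicit Types (f : {mpoly K[n]}) (i j : 'I_n.-1) (p q : {mpoly K[2]}).

Notation u := ('X_ord0 : {mpoly K[2]}).
Notation v := ('X_ord_max : {mpoly K[2]}).

Lemma at_idxE i p : at_idx i p = ev (@mpolyC n K) (xl K i) (xr K i) p.
Proof.
rewrite /at_idx -(evE (f := comp_mpoly [tuple xl K i; xr K i]) (c := @mpolyC n K)) //=.
- by move=> a; rewrite comp_mpolyC.
- by rewrite comp_mpolyXU.
- by rewrite comp_mpolyXU.
Qed.

Lemma evn_at_idx (A : comNzRingType) (c : {rmorphism K -> A}) x i p :
  evn c x (at_idx i p) = ev c (x (lvar i)) (x (rvar i)) p.
Proof.
rewrite at_idxE (ev_rmorph (c' := c) (g := evn c x)) => [|a] /=.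
  by rewrite /xl /xr !evnX.
by rewrite evnC.
Qed.

Lemma lvar_neq_rvar i : lvar i != rvar i.
Proof. by rewrite -val_eqE /= neq_ltn ltnSn. Qed.

Lemma xl_xr_neq0 i : xl K i - xr K i != 0.
Proof.
rewrite subr_eq0; apply/eqP => /(congr1 (mcoeff U_(lvar i)%MM)).
rewrite !mcoeffXU eqxx eq_sym (negPf (lvar_neq_rvar i)).
by apply/eqP; rewrite oner_eq0.
Qed.

Lemma swap_at_idx i p : swap i (at_idx i p) = at_idx i (sw p).
Proof.
rewrite !at_idxE ev_sw /swap.
rewrite (ev_rmorph (c' := @mpolyC n K) (g := msym (tperm (lvar i) (rvar i)))) => [|a] /=.
  by rewrite /xl /xr -!/(swap i _) !swapX tpermL tpermR.
by rewrite /msym mmapC.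
Qed.

Lemma swapM i f g : swap i (f * g) = swap i f * swap i g.
Proof. exact: msymM. Qed.

Definition is_op i (F : {mpoly K[n]} -> {mpoly K[n]}) p q :=
  forall f, (xl K i - xr K i) * F f = at_idx i p * f - at_idx i q * swap i f.

Lemma at_idx_u i : at_idx i u = xl K i.
Proof. by rewrite at_idxE evX0. Qed.

Lemma at_idx_v i : at_idx i v = xr K i.
Proof. by rewrite at_idxE evX1. Qed.

Fact at_idx_is_zmod_morphism i : zmod_morphism (@at_idx K n i).
Proof. by move=> p q; rewrite !at_idxE rmorphB. Qed.

Fact at_idx_is_monoid_morphism i : monoid_morphism (@at_idx K n i).
Proof. by split=> [|p q]; rewrite !at_idxE ?rmorph1 ?rmorphM. Qed.

HB.instance Definition _ i := GRing.isZmodMorphism.Build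
  {mpoly K[2]} {mpoly K[n]} (@at_idx K n i) (at_idx_is_zmod_morphism i).
HB.instance Definition _ i := GRing.isMonoidMorphism.Build
  {mpoly K[2]} {mpoly K[n]} (@at_idx K n i) (at_idx_is_monoid_morphism i).

Lemma pddo_is_op i P Q R S :
  is_op i (pddo i P Q R S) (P + Q + (u - v) * R) (Q0poly P Q S).
Proof.
move=> f; rewrite /pddo /Q0poly swE !mulrDr ddiffP mulrCA ddiffP swapM swap_at_idx.
by rewrite !rmorphB !rmorphD !rmorphM !rmorphB /= at_idx_u at_idx_v; ring.
Qed.

Lemma evn_op (L : fieldType) (c : {rmorphism K -> L}) x i F p q f :
    is_op i F p q -> x (lvar i) != x (rvar i) ->
  evn c x (F f) = coef_id c p (x (lvar i)) (x (rvar i)) * evn c x f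
    + coef_sw c q (x (lvar i)) (x (rvar i)) * evn c (x \o tperm (lvar i) (rvar i)) f.
Proof.
move=> Fop nx; have nz : x (lvar i) - x (rvar i) != 0 by rewrite subr_eq0.
apply: (mulfI nz); have := congr1 (evn c x) (Fop f).
rewrite !(rmorphB, rmorphM) /= /xl /xr !evnX !evn_at_idx evn_swap => ->.
by rewrite !(coef_id.unlock, coef_sw.unlock); field.
Qed.

Lemma op_good i F p q : is_op i F p q -> (exists f, F f != 0) -> good p q.
Proof.
move=> Fop [f nzF]; split; last first.
  apply: contraNT nzF; rewrite negb_or !negbK => /andP[/eqP p0 /eqP q0].
  have := Fop f; rewrite p0 q0 !rmorph0 !mul0r subrr => /eqP.
  by rewrite mulf_eq0 (negPf (xl_xr_neq0 i)).
(* This point, with x_i = u and every other variable v, recovers a two-variable polynomial from its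
   image under [at_idx i]. *)
pose x k := if k == lvar i then u else v.
exists (evn (@mpolyC 2 K) x (F 1)).
have := congr1 (evn (@mpolyC 2 K) x) (Fop 1).
have -> : swap i (1 : {mpoly K[n]}) = 1 by apply: msym1.
rewrite !mulr1 !(rmorphB, rmorphM) /= /xl /xr !evnX !evn_at_idx /x eqxx.
by rewrite eq_sym (negPf (lvar_neq_rvar i)) !ev_id.
Qed.

Lemma op_scalar i F w : is_op i F ((u - v) * w) 0 -> forall f, F f = at_idx i w * f.
Proof.
move=> Fop f; apply: (mulfI (xl_xr_neq0 i)); rewrite Fop rmorph0 mul0r subr0.
by rewrite rmorphM rmorphB /= at_idx_u at_idx_v mulrA.
Qed.

Lemma at_idx_inj i : injective (@at_idx K n i).
Proof.
move=> p q pq; pose x k := if k == lvar i then u else v.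
have := congr1 (evn (@mpolyC 2 K) x) pq.
by rewrite !evn_at_idx /x eqxx eq_sym (negPf (lvar_neq_rvar i)) !ev_id.
Qed.

(** Testing on 1 and on x_i separates the identity part from the swapped part. *)
Lemma op_unique i F p q p' q' : is_op i F p q -> is_op i F p' q' -> p = p' /\ q = q'.
Proof.
move=> Fop Fop'.
have E f : (at_idx i (p - p') * f) = at_idx i (q - q') * swap i f.
  apply/eqP; rewrite -subr_eq0; apply/eqP.
  have e := Fop f; rewrite Fop' in e.
  rewrite !rmorphB /= -[RHS](subrr (at_idx i p * f - at_idx i q * swap i f)) -{2}e; ring.
have E1 : at_idx i (p - p') = at_idx i (q - q').
  by have := E 1; rewrite mulr1 /swap msym1 mulr1.
have := E (xl K i); rewrite swapX tpermL -/(xr K i) E1 => /eqP.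
rewrite -subr_eq0 -mulrBr mulf_eq0 (negPf (xl_xr_neq0 i)) orbF => /eqP q0.
rewrite q0 in E1.
by split; apply: (@at_idx_inj i); apply/eqP; rewrite -subr_eq0 -rmorphB /= ?E1 ?q0.
Qed.

End Operators.

(** Two coordinates of a permuted point (x, y, z) already identify the permutation, so monomials in
    two variables separate the six evaluations. *)
Lemma dedekind_S3 (F : fieldType) (x y z c1 cs ct cst cts csts : F) :
    x != y -> y != z -> x != z ->
    (forall k l : nat, c1 * (x ^+ k * y ^+ l) + cs * (y ^+ k * x ^+ l)
      + ct * (x ^+ k * z ^+ l) + cst * (y ^+ k * z ^+ l)
      + cts * (z ^+ k * x ^+ l) + csts * (z ^+ k * y ^+ l) = 0) ->
  [/\ c1 = 0, cs = 0, ct = 0, cst = 0 & cts = 0 /\ csts = 0].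
Proof.
rewrite -!(subr_eq0 x) -(subr_eq0 y) => xy yz xz H.
(* The polynomial [(s - s1) (s - s2) (t - t1)] vanishes at all but one of the
   six points. *)
pose G s1 s2 t1 (s t : F) := (s - s1) * (s - s2) * (t - t1).
have HG s1 s2 t1 : c1 * G s1 s2 t1 x y + cs * G s1 s2 t1 y x
    + ct * G s1 s2 t1 x z + cst * G s1 s2 t1 y z
    + cts * G s1 s2 t1 z x + csts * G s1 s2 t1 z y = 0.
  have comb (e1 e2 e3 e4 e5 e6 : F) : e1 = 0 -> e2 = 0 -> e3 = 0 -> e4 = 0 ->
      e5 = 0 -> e6 = 0 ->
      e1 - t1 * e2 - (s1 + s2) * e3 + (s1 + s2) * t1 * e4 + s1 * s2 * e5
        - s1 * s2 * t1 * e6 = 0.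
    by move=> -> -> -> -> -> ->; ring.
  by rewrite -[RHS](comb _ _ _ _ _ _ (H 2 1) (H 2 0) (H 1 1) (H 1 0) (H 0 1) (H 0 0)) /G; ring.
have key (d e : F) : d != 0 -> e * d = 0 -> e = 0.
  by move=> nz /eqP; rewrite mulf_eq0 (negPf nz) orbF => /eqP.
have yx : y - x != 0 by rewrite -opprB oppr_eq0.
have zy : z - y != 0 by rewrite -opprB oppr_eq0.
have zx : z - x != 0 by rewrite -opprB oppr_eq0.
split; last split.
- apply: (key ((x - y) * (x - z) * (y - z))); first by rewrite !mulf_neq0.
  by rewrite -(HG y z z) /G; ring.
- apply: (key ((y - x) * (y - z) * (x - z))); first by rewrite !mulf_neq0.
  by rewrite -(HG x z z) /G; ring.
- apply: (key ((x - y) * (x - z) * (z - y))); first by rewrite !mulf_neq0.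
  by rewrite -(HG y z y) /G; ring.
- apply: (key ((y - x) * (y - z) * (z - x))); first by rewrite !mulf_neq0.
  by rewrite -(HG x z x) /G; ring.
- apply: (key ((z - x) * (z - y) * (x - y))); first by rewrite !mulf_neq0.
  by rewrite -(HG x y y) /G; ring.
- apply: (key ((z - x) * (z - y) * (y - x))); first by rewrite !mulf_neq0.
  by rewrite -(HG x y x) /G; ring.
Qed.

(** * Braid relations at a point *)

Section Braid.
Variables (K : fieldType) (n : nat).
Implicit Types (f : {mpoly K[n]}) (i j : 'I_n.-1) (p q : {mpoly K[2]}).

Notation u := ('X_ord0 : {mpoly K[2]}).
Notation v := ('X_ord_max : {mpoly K[2]}).

Lemma rvar_next i j : j = i.+1 :> nat -> rvar i = lvar j.
Proof. by move=> ji; apply: val_inj; rewrite /= ji. Qed.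

Section Expansion.
Variables (i j : 'I_n.-1) (F1 F2 : {mpoly K[n]} -> {mpoly K[n]}).
Variables (p1 q1 p2 q2 : {mpoly K[2]}).
Hypothesis ji : j = i.+1 :> nat.
Hypothesis op1 : is_op i F1 p1 q1.
Hypothesis op2 : is_op j F2 p2 q2.
Variables (L : fieldType) (c : {rmorphism K -> L}) (X : 'I_n -> L).
Notation x := (X (lvar i)).
Notation y := (X (rvar i)).
Notation z := (X (rvar j)).
Hypotheses (xy : x != y) (yz : y != z) (xz : x != z).

Let s := tperm (lvar i) (rvar i).
Let t := tperm (lvar j) (rvar j).
Notation A1 := (coef_id c p1).
Notation B1 := (coef_sw c q1).
Notation A2 := (coef_id c p2).
Notation B2 := (coef_sw c q2).

Lemma lvar_neq_rvar_next : lvar i != rvar j.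
Proof. by rewrite -val_eqE /= ji neq_ltn ltnW. Qed.

Let nx := rvar_next ji.

Lemma adj_tperm : [/\ s (lvar i) = rvar i, s (rvar i) = lvar i & s (rvar j) = rvar j] /\
  [/\ t (lvar i) = lvar i, t (rvar i) = rvar j & t (rvar j) = rvar i].
Proof.
have nrn := lvar_neq_rvar j; have nln := lvar_neq_rvar_next.
split; split; rewrite ?tpermL ?tpermR //.
- by rewrite tpermD // nx.
- by rewrite tpermD // eq_sym // -nx lvar_neq_rvar.
- by rewrite /t nx tpermL.
Qed.

Lemma evn_op1 w f : w (lvar i) != w (rvar i) -> evn c w (F1 f) =
  A1 (w (lvar i)) (w (rvar i)) * evn c w f + B1 (w (lvar i)) (w (rvar i)) * evn c (w \o s) f.
Proof. exact: evn_op. Qed.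

Lemma evn_op2 w f : w (rvar i) != w (rvar j) -> evn c w (F2 f) =
  A2 (w (rvar i)) (w (rvar j)) * evn c w f + B2 (w (rvar i)) (w (rvar j)) * evn c (w \o t) f.
Proof. by rewrite nx; apply: evn_op. Qed.

(** Each swap moves the point at which the next operator is evaluated, which permutes the arguments
    of A and B; the two terms that return to X are merged. *)
Lemma expand_sts f : evn c X (F1 (F2 (F1 f))) =
  (A1 x y ^+ 2 * A2 y z + B1 x y * B1 y x * A2 x z) * evn c X f
  + (A1 x y * A2 y z * B1 x y + B1 x y * A2 x z * A1 y x) * evn c (X \o s) f
  + A1 x y * B2 y z * A1 x z * evn c (X \o t) f
  + B1 x y * B2 x z * A1 y z * evn c (X \o s \o t) f
  + A1 x y * B2 y z * B1 x z * evn c (X \o t \o s) f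
  + B1 x y * B2 x z * B1 y z * evn c (X \o s \o t \o s) f.
Proof.
have [[sl sr sn] [tl tr tn]] := adj_tperm.
have yx : y != x by rewrite eq_sym.
have ss : X \o s \o s =1 X by move=> k /=; rewrite tpermK.
rewrite evn_op1 // !evn_op2 /= ?(sl, sr, sn) // !evn_op1 /= ?(sl, sr, sn, tl, tr, tn) //.
by rewrite (eq_evn c ss); ring.
Qed.

Lemma expand_tst f : evn c X (F2 (F1 (F2 f))) =
  (A2 y z ^+ 2 * A1 x y + B2 y z * B2 z y * A1 x z) * evn c X f
  + A2 y z * B1 x y * A2 x z * evn c (X \o s) f
  + (A2 y z * A1 x y * B2 y z + B2 y z * A1 x z * A2 z y) * evn c (X \o t) f
  + A2 y z * B1 x y * B2 x z * evn c (X \o s \o t) f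
  + B2 y z * B1 x z * A2 x y * evn c (X \o t \o s) f
  + B2 y z * B1 x z * B2 x y * evn c (X \o s \o t \o s) f.
Proof.
have [[sl sr sn] [tl tr tn]] := adj_tperm.
have zy : z != y by rewrite eq_sym.
have tt : X \o t \o t =1 X by move=> k /=; rewrite tpermK.
(* The braid relation in the symmetric group aligns the longest term with that of [expand_sts]. *)
have tst : X \o t \o s \o t =1 X \o s \o t \o s.
  move=> k /=; congr (X _).
  have [->|kl] := eqVneq k (lvar i); first by rewrite !(sl, sr, sn, tl, tr, tn).
  have [->|kr] := eqVneq k (rvar i); first by rewrite !(sl, sr, sn, tl, tr, tn).
  have [->|kn] := eqVneq k (rvar j); first by rewrite !(sl, sr, sn, tl, tr, tn).
  have sk : s k = k by rewrite tpermD // eq_sym.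
  have tk : t k = k by rewrite tpermD // -?nx eq_sym.
  by rewrite !(sk, tk).
rewrite evn_op2 // !evn_op1 /= ?(tl, tr, tn) // !evn_op2 /= ?(sl, sr, sn, tl, tr, tn) //.
by rewrite (eq_evn c tt) (eq_evn c tst); ring.
Qed.

Lemma braid_eqs_of_braid :
    (forall f, F1 (F2 (F1 f)) = F2 (F1 (F2 f))) -> braid_eqs c p1 q1 p2 q2 x y z.
Proof.
move=> br; have [[sl sr sn] [tl tr tn]] := adj_tperm.
have [] := dedekind_S3 (x := x) (y := y) (z := z)
  (c1 := (A1 x y ^+ 2 * A2 y z + B1 x y * B1 y x * A2 x z)
     - (A2 y z ^+ 2 * A1 x y + B2 y z * B2 z y * A1 x z))
  (cs := (A1 x y * A2 y z * B1 x y + B1 x y * A2 x z * A1 y x)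
     - A2 y z * B1 x y * A2 x z)
  (ct := A1 x y * B2 y z * A1 x z
     - (A2 y z * A1 x y * B2 y z + B2 y z * A1 x z * A2 z y))
  (cst := B1 x y * B2 x z * A1 y z - A2 y z * B1 x y * B2 x z)
  (cts := A1 x y * B2 y z * B1 x z - B2 y z * B1 x z * A2 x y)
  (csts := B1 x y * B2 x z * B1 y z - B2 y z * B1 x z * B2 x y) => //.
  move=> k l; have := expand_sts ('X_(lvar i) ^+ k * 'X_(rvar i) ^+ l).
  rewrite br expand_tst !rmorphM !rmorphXn /= !evnX /= !(sl, sr, sn, tl, tr, tn) => e.
  by move/esym/eqP: e; rewrite -subr_eq0 => /eqP e; rewrite -[RHS]e; ring.
move=> e1 es et est [ets ests]; split.
- by apply/eqP; rewrite -subr_eq0 e1.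
- by rewrite -[RHS]es; ring.
- by rewrite -[RHS]et; ring.
- by rewrite -[RHS]est; ring.
- by rewrite -[RHS]ets; ring.
- by apply/eqP; rewrite -subr_eq0 ests.
Qed.

Lemma braid_of_braid_eqs f : braid_eqs c p1 q1 p2 q2 x y z ->
  evn c X (F1 (F2 (F1 f))) = evn c X (F2 (F1 (F2 f))).
Proof.
case=> e1 es et est ets ests; rewrite expand_sts expand_tst e1 ests.
apply/eqP; rewrite -subr_eq0; apply/eqP.
have comb (a1 a2 a3 a4 b1 b2 b3 b4 : L) : a1 = 0 -> a2 = 0 -> a3 = 0 -> a4 = 0 ->
    a1 * b1 + a2 * b2 + a3 * b3 + a4 * b4 = 0.
  by move=> -> -> -> ->; rewrite !mul0r !addr0.
rewrite -[RHS](comb _ _ _ _ (evn c (X \o s) f) (evn c (X \o t) f)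
  (evn c (X \o s \o t) f) (evn c (X \o t \o s) f) es et est ets); ring.
Qed.

End Expansion.
End Braid.

(** * The generic point *)

Section GenericPoint.
Variables (K : fieldType) (n : nat).
Implicit Types (f : {mpoly K[n]}) (i j k : 'I_n.-1) (p q : {mpoly K[2]}).

Notation u := ('X_ord0 : {mpoly K[2]}).
Notation v := ('X_ord_max : {mpoly K[2]}).
Notation L := {fraction {mpoly K[n]}}.

(** Evaluation at the point [frac_var] is the inclusion of polynomials into their fraction field, so
    equality at this single point is equality of polynomials. *)
Definition frac_const : {rmorphism K -> L} := @tofrac _ \o @mpolyC n K.

Definition frac_var (k : 'I_n) : L := tofrac 'X_k.

Lemma evn_frac f : evn frac_const frac_var f = tofrac f.
Proof.
apply: (mpoly_rmorph_ext (f := evn frac_const frac_var) (g := @tofrac _)) => [a|k] /=.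
  by rewrite evnC.
by rewrite evnX.
Qed.

Lemma evn_frac_inj : injective (evn frac_const frac_var).
Proof. by move=> f g; rewrite !evn_frac => /eqP; rewrite tofrac_eq => /eqP. Qed.

Lemma frac_var_generic a b : a != b -> generic frac_const (frac_var a) (frac_var b).
Proof.
move=> ab p; pose e := ev (@mpolyC n K) 'X_a 'X_b p.
have -> : ev frac_const (frac_var a) (frac_var b) p = tofrac e.
  by rewrite /e (ev_rmorph (c' := frac_const) (g := @tofrac _)).
move/eqP; rewrite tofrac_eq0 => /eqP e0.
pose x (k : 'I_n) := if k == a then u else v.
have <- : evn (@mpolyC 2 K) x e = p; last by rewrite e0 rmorph0.
rewrite /e (ev_rmorph (c' := @mpolyC 2 K) (g := evn (@mpolyC 2 K) x)) => [|d] /=.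
  by rewrite !evnX /x eqxx eq_sym (negPf ab) ev_id.
by rewrite evnC.
Qed.

Lemma frac_var_neq a b : a != b -> frac_var a != frac_var b.
Proof. by move/frac_var_generic/generic_neq. Qed.

(** The powers of a variable provide the infinitely many elements that root counting requires. *)
Lemma frac_var_exp_inj (k : 'I_n) : injective (fun m : nat => frac_var k ^+ m).
Proof.
move=> m m'; rewrite /frac_var -!rmorphXn /= => /eqP; rewrite tofrac_eq => /eqP.
move/(congr1 (evn (@polyC K) (fun=> 'X)))/(congr1 (fun g : {poly K} => size g)).
by rewrite !rmorphXn /= evnX !size_polyXn => -[].
Qed.

End GenericPoint.

(** * Relations deduced from the equations *)

Section Relations.
Variables (K : fieldType) (n : nat).
Implicit Types (f : {mpoly K[n]}) (i j k : 'I_n.-1) (p q : {mpoly K[2]}).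

Notation u := ('X_ord0 : {mpoly K[2]}).
Notation v := ('X_ord_max : {mpoly K[2]}).
Notation c0 := (frac_const K n).
Notation X0 := (@frac_var K n).

Lemma op_commute i k F p q F' p' q' : (i.+1 < k)%N || (k.+1 < i)%N ->
    is_op i F p q -> is_op k F' p' q' -> forall f, F (F' f) = F' (F f).
Proof.
move=> ik op op' f; apply: (@evn_frac_inj K n).
pose s := tperm (lvar i) (rvar i); pose t := tperm (lvar k) (rvar k).
have neq : [/\ lvar i != lvar k, lvar i != rvar k, rvar i != lvar k & rvar i != rvar k].
  by rewrite -!val_eqE /=; case/orP: ik => ik; split; apply/eqP; lia.
case: neq => ll lr rl rr.
have il := lvar_neq_rvar i; have kl := lvar_neq_rvar k.
have tl : t (lvar i) = lvar i by rewrite tpermD // eq_sym.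
have tr : t (rvar i) = rvar i by rewrite tpermD // eq_sym.
have sl : s (lvar k) = lvar k by rewrite tpermD.
have sr : s (rvar k) = rvar k by rewrite tpermD.
have st : X0 \o s \o t =1 X0 \o t \o s.
  move=> m /=; congr X0.
  have [->|ml] := eqVneq m (lvar i); first by rewrite tl /s tpermL tr.
  have [->|mr] := eqVneq m (rvar i); first by rewrite tr /s tpermR tl.
  have sm : s m = m by rewrite tpermD // eq_sym.
  have [->|ml'] := eqVneq m (lvar k); first by rewrite sl /t tpermL sr.
  have [->|mr'] := eqVneq m (rvar k); first by rewrite sr /t tpermR sl.
  have tm : t m = m by rewrite tpermD // eq_sym.
  by rewrite tm sm tm.
rewrite (evn_op _ _ op) ?frac_var_neq // (evn_op _ _ op') ?frac_var_neq //.
rewrite !(evn_op _ _ op') ?frac_var_neq //= ?(sl, sr) ?frac_var_neq //.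
rewrite !(evn_op _ _ op) ?frac_var_neq //= -/s -/t ?(tl, tr) ?frac_var_neq //.
by rewrite (eq_evn _ st); ring.
Qed.

Lemma op_linear i F p q a f : is_op i F p q -> F (a *: f) = a *: F f.
Proof.
move=> op; apply: (mulfI (xl_xr_neq0 K i)); rewrite -[RHS]scalerAr !op /swap msymZ.
by rewrite -!scalerAr -scalerBr.
Qed.

Lemma coef_sum_pair (L : fieldType) (c : {rmorphism K -> L}) m p q x y :
  x != y -> hecke_pair m p q -> coef_id c p x y + coef_id c p y x = c m.
Proof.
move=> xy [h _]; have nz : x - y != 0 by rewrite subr_eq0.
have -> : coef_id c p x y + coef_id c p y x = ev c x y (p - sw p) / (x - y).
  by rewrite !coef_id.unlock rmorphB /= ev_sw -(opprB x y) invrN mulrN mulrBl.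
by rewrite h rmorphM rmorphB /= evX0 evX1 evC mulrAC divff // mul1r.
Qed.

Lemma coef_prod_pair (L : fieldType) (c : {rmorphism K -> L}) m p q x y :
  hecke_pair m p q ->
  coef_sw c q x y * coef_sw c q y x = coef_id c p x y * coef_id c p y x.
Proof.
case=> _ h; rewrite !(coef_id.unlock, coef_sw.unlock) mulrNN.
have -> : ev c y x p = ev c x y (sw p) by rewrite ev_sw.
have -> : ev c y x q = ev c x y (sw q) by rewrite ev_sw.
by rewrite mulrACA [RHS]mulrACA -!rmorphM h.
Qed.

(** With A' and B' for the transposed arguments, pi^2 = (A^2 + B B') + (A + A') B s; substituting B
    B' = A A' and A + A' = m gives m (A + B s). *)
Lemma hecke_pair_quadratic i F m p q f :
  is_op i F p q -> hecke_pair m p q -> F (F f) = m *: F f.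
Proof.
move=> op hp; apply: (@evn_frac_inj K n).
pose s := tperm (lvar i) (rvar i); have il := lvar_neq_rvar i.
have ri : X0 (rvar i) != X0 (lvar i) by rewrite frac_var_neq // eq_sym.
have ss : X0 \o s \o s =1 X0 by move=> k /=; rewrite tpermK.
rewrite evnZ -(coef_sum_pair (frac_const K n) (frac_var_neq K il) hp).
rewrite (evn_op _ _ op) ?frac_var_neq // !(evn_op _ _ op) ?frac_var_neq //=.
  rewrite tpermL tpermR -/s (eq_evn _ ss).
  have := coef_prod_pair (frac_const K n) (X0 (lvar i)) (X0 (rvar i)) hp.
  set a := coef_id _ _ _ _; set a' := coef_id _ _ _ _; set b := coef_sw _ _ _ _; set b' := coef_sw _ _ _ _.
  move=> bb.
  transitivity (a ^+ 2 * evn c0 X0 f + (b * b') * evn c0 X0 f + (a + a') * b * evn c0 (X0 \o s) f).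
    by ring.
  by rewrite bb; ring.
by rewrite tpermL tpermR eq_sym.
Qed.

Lemma braid_rel_of_braid (L : fieldType) (c : {rmorphism K -> L}) i j F1 F2 p1 q1 p2 q2 :
    j = i.+1 :> nat -> is_op i F1 p1 q1 -> is_op j F2 p2 q2 ->
    (forall f, F1 (F2 (F1 f)) = F2 (F1 (F2 f))) ->
  braid_rel c p1 q1 p2 q2.
Proof.
move=> ji op1 op2 br x y z xy yz xz.
pose X (k : 'I_n) := if k == lvar i then x else if k == rvar i then y else z.
have Xl : X (lvar i) = x by rewrite /X eqxx.
have Xr : X (rvar i) = y by rewrite /X eq_sym (negPf (lvar_neq_rvar i)) eqxx.
have Xn : X (rvar j) = z.
  rewrite /X eq_sym (negPf (lvar_neq_rvar_next ji)) (rvar_next ji) eq_sym.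
  by rewrite (negPf (lvar_neq_rvar j)).
have := braid_eqs_of_braid ji op1 op2 c (X := X).
by rewrite Xl Xr Xn; apply.
Qed.

(** For a product of linear factors the brackets of [braid_s] and [braid_t] vanish identically. Once
    B B' is replaced by A A', [braid_1] is a combination of them, and [braid_sts] is checked for all
    sixteen choices of q1 and q2. *)
Lemma lin_braid (L : fieldType) (c : {rmorphism K -> L}) al be ga de q1 q2 m x y z :
    x != y -> y != z -> x != z ->
    let p := lin al be u * lin ga de v in
    lin_product al be ga de q1 -> lin_product al be ga de q2 ->
    hecke_pair m p q1 -> hecke_pair m p q2 ->
  braid_eqs c p q1 p q2 x y z.
Proof.
move=> xy yz xz p Pq1 Pq2 h1 h2.
have xy0 : x - y != 0 by rewrite subr_eq0.
have yz0 : y - z != 0 by rewrite subr_eq0.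
have xz0 : x - z != 0 by rewrite subr_eq0.
have yx0 : y - x != 0 by rewrite subr_eq0 eq_sym.
have zy0 : z - y != 0 by rewrite subr_eq0 eq_sym.
have evp s t : ev c s t p = (c al * s + c be) * (c ga * t + c de).
  by rewrite rmorphM /= !ev_lin evX0 evX1.
have e1 : coef_id c p x y * coef_id c p y z + coef_id c p x z * coef_id c p y x
    - coef_id c p y z * coef_id c p x z = 0.
  by rewrite !coef_id.unlock !evp; field; rewrite xy0 yz0 xz0 yx0.
have e2 : coef_id c p x y * coef_id c p x z
    - coef_id c p y z * coef_id c p x y - coef_id c p x z * coef_id c p z y = 0.
  by rewrite !coef_id.unlock !evp; field; rewrite xy0 yz0 xz0 zy0.
split; rewrite ?e1 ?e2 ?subrr ?mulr0 //.
- rewrite (coef_prod_pair _ _ _ h1) (coef_prod_pair _ _ _ h2).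
  apply/eqP; rewrite -subr_eq0; apply/eqP.
  have comb (a b e e' : L) : e = 0 -> e' = 0 -> a * e + b * e' = 0.
    by move=> -> ->; rewrite !mulr0 addr0.
  by rewrite -[RHS](comb (coef_id c p x y) (coef_id c p y z) _ _ e1 e2); ring.
- suff E : ev c x y q1 * ev c x z q2 * ev c y z q1 = ev c y z q2 * ev c x z q1 * ev c x y q2.
    rewrite !coef_sw.unlock.
    transitivity (- (ev c x y q1 * ev c x z q2 * ev c y z q1)
       / ((x - y) * (x - z) * (y - z))); first by field; rewrite xy0 xz0 yz0.
    by rewrite E; field; rewrite xy0 xz0 yz0.
  by case: Pq1 => ->; case: Pq2 => ->; rewrite !rmorphM /= !ev_lin !(evX0, evX1); ring.
Qed.

End Relations.

(** * The four triples *)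

Section Triples.
Variables (K : fieldType) (n : nat).
Implicit Types (f : {mpoly K[n]}) (i j k : 'I_n.-1) (p q : {mpoly K[2]}).

Notation u := ('X_ord0 : {mpoly K[2]}).
Notation v := ('X_ord_max : {mpoly K[2]}).

Lemma at_idxZ i a p : at_idx i (a *: p) = a *: (at_idx i p : {mpoly K[n]}).
Proof. by rewrite at_idxE evZ mul_mpolyC -at_idxE. Qed.

Lemma at_idxC i (a : K) : at_idx i a%:MP = a%:MP :> {mpoly K[n]}.
Proof. by rewrite at_idxE evC. Qed.

Lemma has_tripleP (pi : 'I_n.-1 -> {mpoly K[n]} -> {mpoly K[n]}) i P Q R :
  has_triple pi i (at_idx i P) (at_idx i Q) (at_idx i R) <->
  is_op i (pi i) (P + Q + (u - v) * R) (sw P + Q).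
Proof.
have E f : (xl K i - xr K i) * (ddiff i (at_idx i P * f) + at_idx i Q * ddiff i f + at_idx i R * f)
    = at_idx i (P + Q + (u - v) * R) * f - at_idx i (sw P + Q) * swap i f.
  rewrite !mulrDr ddiffP mulrCA ddiffP swapM swap_at_idx !rmorphD !rmorphM !rmorphB /=.
  by rewrite at_idx_u at_idx_v; ring.
split=> h f; first by rewrite h E.
by apply: (mulfI (xl_xr_neq0 K i)); rewrite h E.
Qed.

(** All four triples give the same p and differ only in q. *)
Definition triple_ops (a b c d : K) p q :=
  p = bilin_poly a b c d /\
  [\/ q = bilin_poly a c b d, q = bilin_poly a b c d,
      q = a *: v ^+ 2 + (b + c) *: v + d%:MP | q = a *: u ^+ 2 + (b + c) *: u + d%:MP].

Lemma four_triples (pi : 'I_n.-1 -> {mpoly K[n]} -> {mpoly K[n]}) i p q (a b c d : K) :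
  is_op i (pi i) p q ->
  let x := xl K i in let y := xr K i in
  [\/ has_triple pi i (a *: (x * y) + b *: x + c *: y + d%:MP) 0 0,
      has_triple pi i (a *: (x * y) + c *: x + c *: y + d%:MP)
                   ((b - c) *: x) 0,
      has_triple pi i (a *: x ^+ 2 + (b + c) *: x + c *: y + d%:MP)
                   (- c *: x) (- a *: x) |
      has_triple pi i (c *: y + d%:MP) (a *: x ^+ 2 + b *: x) (- a *: x)] <->
  triple_ops a b c d p q.
Proof.
move=> op x y.
pose P1 := bilin_poly a b c d; pose P2 := bilin_poly a c c d.
pose P3 := a *: u ^+ 2 + (b + c) *: u + c *: v + d%:MP.
pose P4 := c *: v + d%:MP.
have atE : [/\ at_idx i P1 = a *: (x * y) + b *: x + c *: y + d%:MP,
    at_idx i P2 = a *: (x * y) + c *: x + c *: y + d%:MP,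
    at_idx i P3 = a *: x ^+ 2 + (b + c) *: x + c *: y + d%:MP
  & at_idx i P4 = c *: y + d%:MP].
  by split; rewrite !rmorphD /= !at_idxZ ?rmorphXn ?rmorphM /= ?at_idx_u at_idx_v at_idxC.
have [<- <- <- <-] := atE.
have -> : (b - c) *: x = at_idx i ((b - c) *: u) by rewrite at_idxZ at_idx_u.
have -> : - c *: x = at_idx i (- c *: u) by rewrite at_idxZ at_idx_u.
have -> : - a *: x = at_idx i (- a *: u) by rewrite at_idxZ at_idx_u.
have -> : a *: x ^+ 2 + b *: x = at_idx i (a *: u ^+ 2 + b *: u).
  by rewrite rmorphD /= !at_idxZ rmorphXn /= at_idx_u.
rewrite -(rmorph0 (@at_idx K n i)).
have E P Q R p' q' : P + Q + (u - v) * R = p' -> sw P + Q = q' ->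
    has_triple pi i (at_idx i P) (at_idx i Q) (at_idx i R) <-> p = p' /\ q = q'.
  move=> <- <-; apply: iff_trans (has_tripleP _ _ _ _ _) _.
  by split=> [|[<- <-]] //; exact: op_unique.
have or4_iff (A B C D A' B' C' D' : Prop) : (A <-> A') -> (B <-> B') -> (C <-> C') ->
    (D <-> D') -> [\/ A, B, C | D] <-> [\/ A', B', C' | D'].
  by move=> [a1 a2] [b1 b2] [c1 c2] [d1 d2]; split; case=> h;
    [constructor 1|constructor 2|constructor 3|constructor 4|
     constructor 1|constructor 2|constructor 3|constructor 4]; auto.
apply: iff_trans (or4_iff _ _ _ _ _ _ _ _
  (E _ _ _ P1 (bilin_poly a c b d) _ _) (E _ _ _ P1 P1 _ _)
  (E _ _ _ P1 (a *: v ^+ 2 + (b + c) *: v + d%:MP) _ _)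
  (E _ _ _ P1 (a *: u ^+ 2 + (b + c) *: u + d%:MP) _ _)) _.
- by rewrite mulr0 !addr0.
- by rewrite addr0 sw_bilin_poly.
- by rewrite /P2 /P1 /bilin_poly -!mul_mpolyC mpolyCB; ring.
- by rewrite sw_bilin_poly /P1 /bilin_poly -!mul_mpolyC mpolyCB; ring.
- by rewrite /P3 /P1 /bilin_poly -!mul_mpolyC !mpolyCN mpolyCD; ring.
- rewrite /P3 !rmorphD /= !swZ rmorphXn /= swX0 swX1 swC -!mul_mpolyC mpolyCN mpolyCD; ring.
- by rewrite /P4 /P1 /bilin_poly -!mul_mpolyC mpolyCN; ring.
- rewrite /P4 !rmorphD /= !swZ swX1 swC -!mul_mpolyC mpolyCD; ring.
split=> [[] [-> ->]|[-> []] ->]; rewrite /triple_ops.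
- by split=> //; constructor 1.
- by split=> //; constructor 2.
- by split=> //; constructor 3.
- by split=> //; constructor 4.
- by constructor 1.
- by constructor 2.
- by constructor 3.
- by constructor 4.
Qed.

Lemma triple_ops_lin (al be ga de : K) p q :
  triple_ops (al * ga) (al * de) (be * ga) (be * de) p q <->
  p = lin al be u * lin ga de v /\
  lin_product al be ga de q.
Proof.
have quad w : (al * ga) *: w ^+ 2 + (al * de + be * ga) *: w + (be * de)%:MP
    = lin al be w * lin ga de w.
  by rewrite /lin -!mul_mpolyC !mpolyCD !mpolyCM; ring.
have vu : lin al be v * lin ga de u = bilin_poly (al * ga) (be * ga) (al * de) (be * de).
  by rewrite -(swK (_ * _)) rmorphM /= !sw_lin swX0 swX1 -bilin_poly_lin sw_bilin_poly.
by rewrite /triple_ops /lin_product vu !quad bilin_poly_lin.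
Qed.

End Triples.

(** * Families of operators *)

Section Family.
Variables (K : fieldType) (n : nat).
Variables (p q : 'I_n.-1 -> {mpoly K[2]}).
Variable pi : 'I_n.-1 -> {mpoly K[n]} -> {mpoly K[n]}.
Hypothesis pi_op : forall i, is_op i (pi i) (p i) (q i).
Variable I : {set 'I_n.-1}.

Implicit Types (f : {mpoly K[n]}) (i j k : 'I_n.-1).
Notation u := ('X_ord0 : {mpoly K[2]}).
Notation v := ('X_ord_max : {mpoly K[2]}).

Lemma scalar_op i a : (forall f, pi i f = a *: f) -> p i = (u - v) * a%:MP /\ q i = 0.
Proof.
move=> ha; apply: (op_unique (pi_op i)) => f.
by rewrite ha rmorph0 mul0r subr0 rmorphM rmorphB /= at_idx_u at_idx_v at_idxC
  -mul_mpolyC mulrA.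
Qed.

Lemma const_op i a : p i = (u - v) * a%:MP -> q i = 0 -> forall f, pi i f = a *: f.
Proof.
move=> pa q0 f; have := pi_op i; rewrite pa q0 => /op_scalar->.
by rewrite at_idxC mul_mpolyC.
Qed.

(** * Necessity of the conditions *)

Section Forward.
Hypothesis hn : (4 <= n)%N.
Hypothesis pi_neq0 : forall i, exists f, pi i f != 0.
Hypothesis I_def : forall i, i \in I <-> ~ scalar_operator pi i.
Hypothesis pi_braid : braid_relations pi.

Notation c0 := (frac_const K n).
Let k0 : 'I_n := Ordinal (leq_trans (isT : 0 < 4)%N hn).
Let inf (m : nat) := frac_var K k0 ^+ m.
Let inf_inj : injective inf := @frac_var_exp_inj K n k0.
Let G (a : 'I_4) := frac_var K (widen_ord hn a).

Let G_generic a b : a != b -> generic c0 (G a) (G b).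
Proof. by move=> ab; apply: frac_var_generic; rewrite -val_eqE. Qed.

Lemma pi_good i : good (p i) (q i).
Proof. exact: op_good (pi_op i) (pi_neq0 i). Qed.

Lemma pi_braid_rel i j : j = i.+1 :> nat -> braid_rel c0 (p i) (q i) (p j) (q j).
Proof.
move=> ji; apply: (braid_rel_of_braid c0 ji (pi_op i) (pi_op j)).
exact: (pi_braid.2 _ _ ji).
Qed.

(** An inner index has neighbours on both sides; an end index is followed or preceded by a chain of
    two, because n >= 4 provides at least three operators. *)
Lemma q0_const i : q i = 0 -> exists a, p i = (u - v) * a%:MP.
Proof.
move=> q0; have := pi_good i; rewrite q0 => /good0[w nz_w ep].
suff [a ea] : exists a, w = a%:MP by exists a; rewrite ep ea.
have lt_i := ltn_ord i.
pose o (m : nat) (h : (m < n.-1)%N) := Ordinal h.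
have [i0|i_gt0] := posnP i.
  have h1 : (1 < n.-1)%N by lia.
  have h2 : (2 < n.-1)%N by lia.
  have br1 : braid_rel c0 (p i) (q i) (p (o 1 h1)) (q (o 1 h1)).
    by apply: pi_braid_rel; rewrite /= i0.
  have br2 : braid_rel c0 (p (o 1 h1)) (q (o 1 h1)) (p (o 2 h2)) (q (o 2 h2)).
    exact: pi_braid_rel.
  rewrite ep q0 in br1.
  exact: (first_const inf_inj G_generic nz_w (pi_good _) (pi_good _) br1 br2).
have h0 : (i.-1 < n.-1)%N by lia.
have br0 : braid_rel c0 (p (o _ h0)) (q (o _ h0)) (p i) (q i).
  by apply: pi_braid_rel; rewrite /= prednK.
rewrite ep q0 in br0.
have [lt_i1|ge_i1] := ltnP i.+1 n.-1.
  have br1 : braid_rel c0 (p i) (q i) (p (o _ lt_i1)) (q (o _ lt_i1)).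
    exact: pi_braid_rel.
  rewrite ep q0 in br1.
  exact: (middle_const inf_inj G_generic nz_w (pi_good _) (pi_good _) br0 br1).
have h1 : (i.-2 < n.-1)%N by lia.
have br1 : braid_rel c0 (p (o _ h1)) (q (o _ h1)) (p (o _ h0)) (q (o _ h0)).
  by apply: pi_braid_rel => /=; lia.
exact: (last_const inf_inj G_generic nz_w (pi_good _) (pi_good _) br1 br0).
Qed.

Lemma mem_I i : (i \in I) = (q i != 0).
Proof.
apply/idP/idP => [/I_def iI|nz].
  by apply/eqP => q0; apply: iI; have [a pa] := q0_const q0; exists a; exact: const_op.
by apply/I_def => -[a /scalar_op[_ q0]]; rewrite q0 eqxx in nz.
Qed.

Variables (i0 : 'I_n.-1).
Hypothesis q_i0 : q i0 = 0.
Variable mu : K.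
Hypothesis p_i0 : p i0 = (u - v) * mu%:MP.

Lemma mu_neq0 : mu != 0.
Proof.
have [_] := pi_good i0; rewrite q_i0 eqxx orbF p_i0.
by apply: contraNneq => ->; rewrite mpolyC0 mulr0.
Qed.

Lemma op_type_up i j : j = i.+1 :> nat -> op_type mu (p i) (q i) -> op_type mu (p j) (q j).
Proof.
move=> ji; exact: (op_type_next G_generic (pi_good i) (pi_good j) (@q0_const j) (pi_braid_rel ji)).
Qed.

Lemma op_type_down i j : j = i.+1 :> nat -> op_type mu (p j) (q j) -> op_type mu (p i) (q i).
Proof.
move=> ji /op_type_mirror tj; rewrite -[p i]mirrorK -[q i]mirrorK; apply: op_type_mirror.
apply: (op_type_next G_generic (good_mirror (pi_good j)) (good_mirror (pi_good i)) _
  (braid_rel_mirror (pi_braid_rel ji)) tj) => /eqP.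
rewrite mirror_eq0 => /eqP/q0_const[a ->]; exists a.
by rewrite mirrorM swC.
Qed.

(** Induction on the distance from the scalar operator at i0. *)
Lemma op_type_all j : op_type mu (p j) (q j).
Proof.
have t0 : op_type mu (p i0) (q i0) by rewrite /op_type q_i0 eqxx.
have [d] := ubnP `|j - i0|%N; elim: d j => // d IHd j; rewrite ltnS => le_d.
have lt_j := ltn_ord j; have lt_i := ltn_ord i0.
have [ji|ij|/val_inj-> //] := ltngtP j i0.
  have h : (j.+1 < n.-1)%N by lia.
  by apply: (@op_type_down j (Ordinal h)) => //; apply: IHd => /=; lia.
have h : (j.-1 < n.-1)%N by lia.
apply: (@op_type_up (Ordinal h) j) => /=; first by lia.
by apply: IHd => /=; lia.
Qed.

Lemma op_type_in j : j \in I -> hecke_pair mu (p j) (q j).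
Proof. by rewrite mem_I; have := op_type_all j; rewrite /op_type; case: eqP. Qed.

Lemma op_type_notin j : j \notin I -> p j = (u - v) * mu%:MP /\ q j = 0.
Proof. by rewrite mem_I negbK; have := op_type_all j; rewrite /op_type; case: eqP. Qed.

Lemma forward_complement : complement_scalar I pi mu.
Proof.
split; last 1 first.
- by move=> i /op_type_notin[pa q0] f; exact: const_op.
- by apply/set0Pn; exists i0; rewrite inE mem_I q_i0 eqxx.
exact: mu_neq0.
Qed.

Lemma forward_isolated : isolated_form I pi mu.
Proof.
move=> i /andP[iI _]; have [h1 h2] := op_type_in iI.
have nz_q : q i != 0 by rewrite -mem_I.
have [phi [psi [ep eq]]] := hecke_factor nz_q (pi_good i) h2.
exists phi, psi; split=> [f|]; apply: (mulfI (xl_xr_neq0 K i)).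
  by rewrite pi_op ep eq mulrCA ddiffP swapM swap_at_idx !rmorphM /=; ring.
rewrite ddiffP -rmorphM swap_at_idx -rmorphB -ep /= h1.
by rewrite rmorphM rmorphB /= at_idx_u at_idx_v at_idxC.
Qed.

(** All p on J equal the one at its left end a. The pair a, a + 1 makes this p bilinear of
    determinant zero, and b - c = mu <> 0 keeps both of its linear factors nonzero, so
    [four_factors] applies at each index separately. *)
Lemma forward_interval : interval_form I pi mu.
Proof.
move=> J /andP[J_gt1 /maxsetp/andP[/existsP[a /existsP[b /eqP defJ]] JI]].
have memJ j : (j \in J) = (a <= j <= b)%N by rewrite defJ inE.
have lt_ab : (a < b)%N.
  rewrite ltnNge; apply/negP => le_ba; move: J_gt1.
  rewrite ltnNge -(cards1 a) => /negP[]; apply: subset_leq_card; apply/subsetP => j.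
  by rewrite memJ inE -val_eqE /= => /andP[h1 h2]; rewrite eqn_leq h1 (leq_trans h2).
have qJ j : j \in J -> q j != 0 by rewrite -mem_I => jJ; apply: (subsetP JI).
have aJ : a \in J by rewrite memJ leqnn ltnW.
have pJ j : j \in J -> p j = p a.
  have [d] := ubnP (j - a)%N; elim: d j => // d IHd j le_d jJ.
  have := jJ; rewrite memJ => /andP[aj jb].
  have [/val_inj-> //|ne] := eqVneq (a : nat) j.
  have h : (j.-1 < n.-1)%N by have := ltn_ord j; lia.
  have j'J : Ordinal h \in J by rewrite memJ /=; lia.
  rewrite -(IHd _ _ j'J) /=; last by lia.
  have ji : j = (Ordinal h).+1 :> nat by rewrite /=; lia.
  by rewrite (same_coef_id G_generic (pi_braid_rel ji)) ?qJ.
have h : (a.+1 < n.-1)%N by have := ltn_ord b; lia.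
pose a1 : 'I_n.-1 := Ordinal h.
have a1J : a1 \in J by rewrite memJ /= lt_ab leqnSn.
have [hp _] := op_type_in (subsetP JI _ aJ).
have nz_p : p a != 0.
  apply/eqP => p0; move/eqP: hp; rewrite p0 rmorph0 subr0 eq_sym mulf_eq0.
  by rewrite (negPf (subXX_neq0 K)) mpolyC_eq0 (negPf mu_neq0).
have br : braid_rel c0 (p a) (q a) (p a) (q a1).
  by rewrite -{2}(pJ a1) //; apply: pi_braid_rel.
have [A [B [C [D [ep det BC]]]]] :=
  braid_bilinear inf_inj G_generic (qJ _ aJ) (qJ _ a1J) nz_p br hp.
exists A, B, C, D; split=> //.
  by case=> _ B0 C0 _; move: mu_neq0; rewrite -BC B0 C0 subr0 eqxx.
move=> i iJ; apply/(four_triples A B C D (pi_op i)).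
have [al [be [ga [de [eA eB eC eD]]]]] := rank1 det.
have [_ hpq] := op_type_in (subsetP JI _ iJ).
move: ep; rewrite -(pJ i iJ) eA eB eC eD bilin_poly_lin => ep.
apply/triple_ops_lin; split=> //; apply: four_factors ep hpq => //; last exact: pi_good.
  apply/eqP => -[al0 be0]; move: mu_neq0; rewrite -BC eB eC al0 be0 !mul0r subr0 eqxx.
  by [].
apply/eqP => -[ga0 de0]; move: mu_neq0; rewrite -BC eB eC ga0 de0 !mulr0 subr0 eqxx.
by [].
Qed.

End Forward.

(** * Sufficiency of the conditions *)

Section Backward.
Variable mu : K.
Hypothesis compl : complement_scalar I pi mu.
Hypothesis isol : isolated_form I pi mu.
Hypothesis intv : interval_form I pi mu.

(** The consecutive set {i, j} extends to a maximal consecutive subset of I. *)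
Lemma adjacent_interval i j : j = i.+1 :> nat -> i \in I -> j \in I ->
  exists J, [/\ interval_of I J, i \in J & j \in J].
Proof.
move=> ji iI jI; pose J0 := [set k : 'I_n.-1 | (i <= k <= j)%N].
have J0P : [pred B | consecutive B && (B \subset I)] J0.
  apply/andP; split; first by apply/existsP; exists i; apply/existsP; exists j.
  apply/subsetP => k; rewrite inE => /andP[ik kj].
  have [/val_inj<- //|ne] := eqVneq (i : nat) k.
  by suff -> : k = j by []; apply: val_inj => /=; lia.
have [J maxJ sJ] := maxset_exists J0P.
have iJ : i \in J by apply: (subsetP sJ); rewrite inE; lia.
have jJ : j \in J by apply: (subsetP sJ); rewrite inE; lia.
exists J; split=> //; apply/andP; split=> //.
have ij : i != j by rewrite -val_eqE /=; lia.
have sub2 : [set i; j] \subset J by apply/subsetP => k; rewrite !inE => /orP[] /eqP->.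
by have := subset_leq_card sub2; rewrite cards2 ij.
Qed.

Lemma interval_lin J : interval_of I J -> exists al be ga de,
  al * de - be * ga = mu /\ forall i, i \in J -> p i = lin al be u * lin ga de v /\
    lin_product al be ga de (q i).
Proof.
case/intv => a [b [c [d [_ det bc H]]]].
have [al [be [ga [de [ea eb ec ed]]]]] := rank1 det.
exists al, be, ga, de; split=> [|i iJ]; first by rewrite -eb -ec.
apply/triple_ops_lin; rewrite -ea -eb -ec -ed.
exact/(four_triples a b c d (pi_op i))/H.
Qed.

Lemma lin_hecke_pair al be ga de p' q' : al * de - be * ga = mu ->
    p' = lin al be u * lin ga de v ->
    [\/ q' = lin al be v * lin ga de u, q' = lin al be u * lin ga de v,
        q' = lin al be v * lin ga de v | q' = lin al be u * lin ga de u] ->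
  hecke_pair mu p' q'.
Proof.
move=> <- -> hq; split.
  by rewrite rmorphM /= !sw_lin swX0 swX1 /lin -!mul_mpolyC mpolyCB !mpolyCM; ring.
by case: hq => ->; rewrite !rmorphM /= !sw_lin !(swX0, swX1); ring.
Qed.

Lemma hecke_pair_in i : i \in I -> hecke_pair mu (p i) (q i).
Proof.
move=> iI; have [iso|] := boolP (isolated I i).
  have [phi [psi [Hf Hmu]]] := isol iso.
  have [-> ->] : p i = phi * psi /\ q i = phi * sw psi.
    apply: (op_unique (pi_op i)) => f.
    by rewrite Hf mulrCA ddiffP swapM swap_at_idx !rmorphM /=; ring.
  split; last by rewrite !rmorphM /= swK; ring.
  apply: (@at_idx_inj K n i); have := ddiffP i (at_idx i phi * at_idx i psi).
  rewrite Hmu -rmorphM swap_at_idx -rmorphB /= => <-.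
  by rewrite rmorphM rmorphB /= at_idx_u at_idx_v at_idxC.
rewrite /isolated iI /= negb_forall_in => /exists_inP[j jI].
rewrite negb_and !negbK => /orP[] /eqP ij.
  have [J [JI jJ iJ]] := adjacent_interval (esym ij) jI iI.
  have [al [be [ga [de [e /(_ i iJ)[ep eq]]]]]] := interval_lin JI.
  exact: lin_hecke_pair e ep eq.
have [J [JI iJ jJ]] := adjacent_interval (esym ij) iI jI.
have [al [be [ga [de [e /(_ i iJ)[ep eq]]]]]] := interval_lin JI.
exact: lin_hecke_pair e ep eq.
Qed.

Lemma notin_scalar i f : i \notin I -> pi i f = mu *: f.
Proof. by case: compl => _ _ h /h. Qed.

Lemma pi_quadratic i f : pi i (pi i f) = mu *: pi i f.
Proof.
have [iI|iI] := boolP (i \in I); last by rewrite !notin_scalar.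
exact: (hecke_pair_quadratic f (pi_op i) (hecke_pair_in iI)).
Qed.

(** If one of the two operators is mu Id, both sides reduce to multiples of the other by pi^2 = mu
    pi. Otherwise both indices lie in one interval, and [lin_braid] is applied at the generic
    point. *)
Lemma braid_adjacent i j f : j = i.+1 :> nat ->
  pi i (pi j (pi i f)) = pi j (pi i (pi j f)).
Proof.
move=> ji; have piZ k a g : pi k (a *: g) = a *: pi k g by apply: op_linear (pi_op k).
have [iI|iI] := boolP (i \in I); last by rewrite !(notin_scalar _ iI) !piZ pi_quadratic.
have [jI|jI] := boolP (j \in I); last by rewrite !(notin_scalar _ jI) !piZ pi_quadratic.
have [J [JI iJ jJ]] := adjacent_interval ji iI jI.
have [al [be [ga [de [e H]]]]] := interval_lin JI.
have [pi_i qi] := H _ iJ; have [pj qj] := H _ jJ.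
apply: (@evn_frac_inj K n).
have op1 := pi_op i; have op2 := pi_op j; rewrite pi_i in op1; rewrite pj in op2.
have nij := lvar_neq_rvar_next ji.
have nr : rvar i != rvar j by rewrite (rvar_next ji) lvar_neq_rvar.
apply: (braid_of_braid_eqs ji op1 op2); rewrite ?frac_var_neq ?lvar_neq_rvar //.
have hpi : hecke_pair mu (lin al be u * lin ga de v) (q i) by exact: lin_hecke_pair qi.
have hpj : hecke_pair mu (lin al be u * lin ga de v) (q j) by exact: lin_hecke_pair qj.
by apply: (lin_braid _ _ _ _ qi qj hpi hpj); rewrite ?frac_var_neq ?lvar_neq_rvar.
Qed.

Lemma backward_Hecke : generates_Hecke pi mu 0.
Proof.
split; last by move=> i f; rewrite scale0r addr0 pi_quadratic.
split=> [i k ik f|i j ji f]; last exact: braid_adjacent.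
exact: (op_commute ik (pi_op i) (pi_op k)).
Qed.

Lemma backward_q0 : exists i, q i = 0.
Proof.
case: compl => /set0Pn[i]; rewrite inE => iI _ _; exists i.
by have [] := scalar_op (fun f => notin_scalar f iI).
Qed.

End Backward.

End Family.

Theorem theorem31 (K : fieldType) (n : nat) (hn : (4 <= n)%N)
    (P Q R S : 'I_n.-1 -> {mpoly K[2]})
    (pi : 'I_n.-1 -> {mpoly K[n]} -> {mpoly K[n]})
    (pi_pddo : forall i f, pi i f = pddo i (P i) (Q i) (R i) (S i) f)
    (pi_neq0 : forall i, exists f, pi i f != 0)
    (I : {set 'I_n.-1})
    (I_def : forall i, i \in I <-> ~ scalar_operator pi i) :
  ((braid_relations pi /\ exists i, Q0poly (P i) (Q i) (S i) = 0) <->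
   (exists mu : K,
      [/\ complement_scalar I pi mu, isolated_form I pi mu
        & interval_form I pi mu])) /\
  (forall mu : K,
     [/\ complement_scalar I pi mu, isolated_form I pi mu
       & interval_form I pi mu] ->
     generates_Hecke pi mu 0).
Proof.
have pi_op i : is_op i (pi i)
    (P i + Q i + ('X_ord0 - 'X_ord_max) * R i) (Q0poly (P i) (Q i) (S i)).
  by move=> f; rewrite pi_pddo; apply: pddo_is_op.
have hecke mu : [/\ complement_scalar I pi mu, isolated_form I pi mu
       & interval_form I pi mu] -> generates_Hecke pi mu 0.
  by case=> h1 h2 h3; apply: (backward_Hecke pi_op h1 h2 h3).
split=> //; split=> [[br [i q0]]|[mu H]].
  have [mu p_i] := q0_const pi_op hn pi_neq0 br q0.
  exists mu; split.
  - exact: (forward_complement pi_op hn pi_neq0 I_def br q0 p_i).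
  - exact: (forward_isolated pi_op hn pi_neq0 I_def br q0 p_i).
  - exact: (forward_interval pi_op hn pi_neq0 I_def br q0 p_i).
split; first by have [] := hecke _ H.
by case: H => h1 _ _; apply: (backward_q0 pi_op h1).
Qed.
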